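(* Let $g:\mathbb R^{m\times d}\to[0,+\infty)$ be a continuous $d$-homogeneous function and assume that there exists a positive constant $C$ such that $\frac1C|M|^d\le g(M)\le C|M|^d$ for every $M\in\mathbb R^{m\times d}$. For $z\in\mathbb R^m$ let $$\psi(z):=\lim_{L\to+\infty}(\log L)^{d-1}\inf\Bigl\{\int_{Q(L)}g(\nabla v)\,dx: v-z\in W^{1,d}_0(Q(L);\mathbb R^m),\ v=0\text{ on }Q(1)\Bigr\}.$$ Then $\psi:\mathbb R^m\to[0,+\infty)$ is convex.
   Context: $d\ge2$ and $m\ge1$ are integers; $Q(r):=(-\frac r2,\frac r2)^d$. A function $g$ on $\mathbb R^{m\times d}$ is $d$-homogeneous if $g(tM)=t^dg(M)$ for all $t\ge0$ and $M\in\mathbb R^{m\times d}$. It is known that, under the stated assumptions on $g$, the limit defining $\psi(z)$ exists for every $z\in\mathbb R^m$ and that there is a positive constant $C$ such that $\frac1C|z|^d\le\psi(z)\le C|z|^d$ for every $z\in\mathbb R^m$. *)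

(* Defs.v *)
From HB Require Import structures.
From mathcomp Require Import all_boot all_order all_algebra.
From mathcomp Require Import all_classical all_reals all_analysis.

Set Implicit Arguments.
Unset Strict Implicit.
Unset Printing Implicit Defensive.

Import Order.TTheory GRing.Theory Num.Theory.
Import numFieldNormedType.Exports.

Local Open Scope classical_set_scope.
Local Open Scope ring_scope.

(* The sigma-algebra on m x n matrices generated by the m * n entries; over the
   Borel sets of R, this is the Borel sigma-algebra of R^(m x n). *)
Definition mx_display : measure_display -> measure_display.
Proof. exact. Qed.

Section measurable_matrix.
Context {disp : measure_display} {T : measurableType disp}.
Variables m n : nat.

Definition mx_measurable : set (set 'M[T]_(m, n)) :=
  <<s \bigcup_(ij in [set: 'I_m * 'I_n])
        preimage_set_system setT (fun M : 'M[T]_(m, n) => M ij.1 ij.2)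
          measurable >>.

Let mx_measurable0 : mx_measurable set0.
Proof. exact: sigma_algebra0. Qed.

Let mx_measurableC A : mx_measurable A -> mx_measurable (~` A).
Proof. exact: sigma_algebraC. Qed.

Let mx_measurable_bigcup (F : (set 'M[T]_(m, n))^nat) :
  (forall i, mx_measurable (F i)) -> mx_measurable (\bigcup_i F i).
Proof. exact: sigma_algebra_bigcup. Qed.

HB.instance Definition _ := @isMeasurable.Build (mx_display disp) 'M[T]_(m, n)
  mx_measurable mx_measurable0 mx_measurableC mx_measurable_bigcup.

End measurable_matrix.

Section measurable_matrix_theory.
Context {disp : measure_display} {T : measurableType disp}.

Lemma measurable_mx_entry m n (i : 'I_m) (j : 'I_n) :
  measurable_fun [set: 'M[T]_(m, n)] (fun M : 'M[T]_(m, n) => M i j).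
Proof.
move=> _ A mA; apply: sub_sigma_algebra; exists (i, j) => //=.
by exists A.
Qed.

Lemma measurable_mxP d' (S : measurableType d') m n (f : S -> 'M[T]_(m, n)) :
  measurable_fun setT f <->
  forall i j, measurable_fun setT (fun x => f x i j).
Proof.
split=> [mf i j|mf].
  exact: (measurableT_comp (measurable_mx_entry i j) mf).
apply: (@measurability _ _ _ _ _ _
  (\bigcup_(ij in [set: 'I_m * 'I_n])
     preimage_set_system setT (fun M : 'M[T]_(m, n) => M ij.1 ij.2)
       measurable)) => //.
move=> _ [_ [[i j] _ [A mA <-]] <-]; rewrite /= !setTI -comp_preimage.
by rewrite -[X in measurable X]setTI; exact: mf.
Qed.

Definition rV_cons n (p : T * 'rV[T]_n) : 'rV[T]_n.+1 :=
  row_mx (const_mx p.1 : 'rV_1) p.2.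

Lemma rV_cons0 n (p : T * 'rV[T]_n) : rV_cons p ord0 ord0 = p.1.
Proof.
by rewrite /rV_cons mxE; case: splitP => [i _|i]; rewrite ?mxE.
Qed.

Lemma rV_consS n (p : T * 'rV[T]_n) (i : 'I_n) :
  rV_cons p ord0 (lift ord0 i) = p.2 ord0 i.
Proof.
rewrite /rV_cons mxE; case: splitP => [j|j /= [ij]].
  by rewrite (ord1 j).
by congr (p.2 _ _); exact/val_inj.
Qed.

Lemma measurable_rV_cons n : measurable_fun setT (@rV_cons n).
Proof.
apply/measurable_mxP => i j; rewrite (ord1 i).
case: (unliftP ord0 j) => [k|] ->.
  under eq_fun do rewrite rV_consS.
  exact: (measurableT_comp (measurable_mx_entry _ _) measurable_snd).
by under eq_fun do rewrite rV_cons0; exact: measurable_fst.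
Qed.

End measurable_matrix_theory.

Section lebesgue_rV.
Context {R : realType}.

Fixpoint lebesgue_rV (n : nat) : set 'rV[R]_n -> \bar R :=
  match n return set 'rV[R]_n -> \bar R with
  | 0 => @dirac _ 'rV[R]_0 0 R
  | k.+1 => pushforward (lebesgue_measure \x @lebesgue_rV k)%E (@rV_cons _ R k)
  end.

Definition rV_box n (A : 'I_n -> set R) : set 'rV[R]_n :=
  [set x | forall i, A i (x ord0 i)].

Lemma measurable_rV_box n (A : 'I_n -> set R) :
  (forall i, measurable (A i)) -> measurable (rV_box A).
Proof.
move=> mA.
have -> : rV_box A =
    \bigcap_(i in [set: 'I_n]) ((fun x : 'rV[R]_n => x ord0 i) @^-1` A i).
  by apply/seteqP; split => x /= H i; [move=> _|]; exact: H.
apply: fin_bigcap_measurable => // i _.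
by rewrite -[X in measurable X]setTI; exact: measurable_mx_entry.
Qed.

Let rV_cons_box n (A : 'I_n.+1 -> set R) :
  @rV_cons _ R n @^-1` rV_box A =
  A ord0 `*` rV_box (fun i => A (lift ord0 i)).
Proof.
apply/seteqP; split => [p /= H|p /= [H0 H] i].
  split; first by have := H ord0; rewrite rV_cons0.
  by move=> i /=; have := H (lift ord0 i); rewrite rV_consS.
by case: (unliftP ord0 i) => [k|] ->; rewrite ?rV_consS ?rV_cons0//; exact: H.
Qed.

Let box_finite_sigma_finite n (nu : {measure set 'rV[R]_n -> \bar R}) :
  (forall A : 'I_n -> set R, (forall i, measurable (A i)) ->
    nu (rV_box A) = \prod_(i < n) lebesgue_measure (A i))%E ->
  sigma_finite setT nu.
Proof.
move=> nuE; exists (fun k => rV_box (fun=> `[- k%:R, k%:R]%classic)).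
  apply/seteqP; split => // x _.
  exists (Num.bound (`|x| : R)) => //= i; rewrite set_itvcc/= -ler_norml.
  have xi : `|x ord0 i| <= `|x|.
    rewrite [leRHS]/Num.Def.normr/= mx_normrE.
    exact: (le_bigmax _ (fun ij => `|x ij.1 ij.2|) (ord0, i)).
  by rewrite (le_trans xi)// ltW// archi_boundP.
move=> k; have mk : forall i : 'I_n, measurable (`[- k%:R, k%:R]%classic : set R).
  by [].
split; first exact: measurable_rV_box.
rewrite nuE// -ge0_fin_numE ?prode_ge0//; apply: prode_fin_num => i _.
by rewrite lebesgue_measure_itv/=; case: ifP.
Qed.

Section lebesgue_rV_step.
Variables (n : nat) (nu : {measure set 'rV[R]_n -> \bar R}).
Hypothesis nu_box : (forall A : 'I_n -> set R, (forall i, measurable (A i)) ->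
  nu (rV_box A) = \prod_(i < n) lebesgue_measure (A i))%E.

Let sfnu : set 'rV[R]_n -> \bar R := nu.
HB.instance Definition _ := Measure.on sfnu.
HB.instance Definition _ := Measure_isSigmaFinite.Build _ _ _
  sfnu (box_finite_sigma_finite nu_box).

Lemma lebesgue_rV_step : exists2 nu' : {measure set 'rV[R]_n.+1 -> \bar R},
    pushforward (lebesgue_measure \x nu)%E (@rV_cons _ R n) = nu' &
    (forall A : 'I_n.+1 -> set R, (forall i, measurable (A i)) ->
      nu' (rV_box A) = \prod_(i < n.+1) lebesgue_measure (A i))%E.
Proof.
exists (measure_function_pushforward__canonical__measure_function_Measure
  (lebesgue_measure \x sfnu)%E (@measurable_rV_cons _ R n)) => // A mA.
rewrite /= /pushforward rV_cons_box product_measure1E; first last.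
- exact: measurable_rV_box.
- exact: mA.
by rewrite big_ord_recl -nu_box.
Qed.

End lebesgue_rV_step.

Let lebesgue_rV_is_measure n : exists2 nu : {measure set 'rV[R]_n -> \bar R},
  @lebesgue_rV n = nu &
  (forall A : 'I_n -> set R, (forall i, measurable (A i)) ->
    nu (rV_box A) = \prod_(i < n) lebesgue_measure (A i))%E.
Proof.
elim: n => [|n [nu nuE nu_box]]; last by rewrite /= nuE; exact: lebesgue_rV_step.
exists (@dirac _ 'rV[R]_0 0 R) => // A mA; rewrite big_ord0.
by rewrite /= /dirac indicE mem_set// => -[].
Qed.

Let lebesgue_rV0 n : @lebesgue_rV n set0 = 0%E.
Proof. by have [nu -> _] := lebesgue_rV_is_measure n; exact: measure0. Qed.

Let lebesgue_rV_ge0 n A : (0 <= @lebesgue_rV n A)%E.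
Proof. by have [nu -> _] := lebesgue_rV_is_measure n; exact: measure_ge0. Qed.

Let lebesgue_rV_additive n : semi_sigma_additive (@lebesgue_rV n).
Proof.
have [nu -> _] := lebesgue_rV_is_measure n.
exact: measure_semi_sigma_additive.
Qed.

HB.instance Definition _ n := isMeasure.Build _ _ _ (@lebesgue_rV n)
  (@lebesgue_rV0 n) (@lebesgue_rV_ge0 n) (@lebesgue_rV_additive n).

Lemma lebesgue_rV_boxE n (A : 'I_n -> set R) : (forall i, measurable (A i)) ->
  lebesgue_rV (rV_box A) = (\prod_(i < n) lebesgue_measure (A i))%E.
Proof. by have [nu -> +] := lebesgue_rV_is_measure n => /[apply]. Qed.

HB.instance Definition _ n := Measure_isSigmaFinite.Build _ _ _
  (@lebesgue_rV n) (box_finite_sigma_finite (@lebesgue_rV_boxE n)).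

End lebesgue_rV.

(* The Euclidean (Frobenius) norm; the library's norm on matrices is the
   maximum of the absolute values of the entries. *)
Definition eucl_norm (R : realType) (a b : nat) (M : 'M[R]_(a, b)) : R :=
  Num.sqrt (\sum_i \sum_j M i j ^+ 2).

Section sobolev.
Context {R : realType} {d : nat}.
Implicit Types (D : set 'rV[R]_d) (f phi : 'rV[R]_d -> R).

Definition partial (j : 'I_d) f : 'rV[R]_d -> R :=
  fun x => 'D_(delta_mx ord0 j) f x.

Definition iter_partial (s : seq 'I_d) f : 'rV[R]_d -> R := foldr partial f s.

(* C^oo: the partial derivatives of every order exist and are continuous;
   [derivable] has to be required since ['D_v f x] is total. *)
Definition smooth f : Prop :=
  forall s : seq 'I_d, continuous (iter_partial s f) /\
    forall (j : 'I_d) (x : 'rV[R]_d),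
      derivable (iter_partial s f) x (delta_mx ord0 j).

Definition supp f : set 'rV[R]_d := closure [set x | f x != 0].

Definition test_function D phi : Prop :=
  [/\ smooth phi, compact (supp phi) & supp phi `<=` D].

Definition inLp (p : nat) D (a b : nat) (f : 'rV[R]_d -> 'M[R]_(a, b)) : Prop :=
  measurable_fun D f /\
  (\int[@lebesgue_rV R d]_(x in D) (eucl_norm (f x) ^+ p)%:E < +oo)%E.

Definition cvgLp (p : nat) D (a b : nat)
    (f_ : nat -> 'rV[R]_d -> 'M[R]_(a, b)) (f : 'rV[R]_d -> 'M[R]_(a, b)) : Prop :=
  (\int[@lebesgue_rV R d]_(x in D) (eucl_norm (f_ k x - f x) ^+ p)%:E)%E
    @[k --> \oo] --> (0 : \bar R).

Section vector_valued.
Context {m : nat}.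
Implicit Types (u : 'rV[R]_d -> 'rV[R]_m) (G : 'rV[R]_d -> 'M[R]_(m, d)).

Definition component u (i : 'I_m) : 'rV[R]_d -> R := fun x => u x ord0 i.

Definition grad u : 'rV[R]_d -> 'M[R]_(m, d) :=
  fun x => \matrix_(i < m, j < d) partial j (component u i) x.

(* u belongs to W^(1,p)(D; R^m) and G is (a representative of) its weak
   gradient *)
Definition W1p (p : nat) D u G : Prop :=
  [/\ inLp p D u, inLp p D G &
    forall (i : 'I_m) (j : 'I_d) phi, test_function D phi ->
      \int[@lebesgue_rV R d]_(x in D) (component u i x * partial j phi x) =
      - \int[@lebesgue_rV R d]_(x in D) (G x i j * phi x)].

(* W^(1,p)_0(D; R^m): the closure of C^oo_c(D; R^m) in W^(1,p)(D; R^m) *)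
Definition W1p0 (p : nat) D u : Prop :=
  exists G, W1p p D u G /\
    exists phi_ : nat -> 'rV[R]_d -> 'rV[R]_m,
      [/\ forall k i, test_function D (component (phi_ k) i),
          cvgLp p D phi_ u &
          cvgLp p D (fun k => grad (phi_ k)) G].

End vector_valued.
End sobolev.

Section capacity.
Context {R : realType} {m d : nat}.

Definition cube (r : R) : set 'rV[R]_d :=
  [set x | forall i, - (r / 2) < x ord0 i < r / 2].

(* The pairs (v, weak gradient of v) with v - z in W^(1,d)_0(Q(L); R^m) and
   v = 0 almost everywhere on Q(1); such a v is in W^(1,d)(Q(L); R^m) since
   Q(L) is bounded. *)
Definition admissible (L : R) (z : 'rV[R]_m)
    (v : 'rV[R]_d -> 'rV[R]_m) (G : 'rV[R]_d -> 'M[R]_(m, d)) : Prop :=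
  [/\ W1p0 d (cube L) (fun x => v x - z),
      {ae @lebesgue_rV R d, forall x, cube 1 x -> v x = 0} &
      W1p d (cube L) v G].

Definition cell_min (g : 'M[R]_(m, d) -> R) (L : R) (z : 'rV[R]_m) : \bar R :=
  ereal_inf [set e | exists v G, admissible L z v G /\
    e = (\int[@lebesgue_rV R d]_(x in cube L) (g (G x))%:E)%E].

Definition homogeneous_of_degree (k : nat) (g : 'M[R]_(m, d) -> R) : Prop :=
  forall (t : R) (M : 'M[R]_(m, d)), 0 <= t -> g (t *: M) = t ^+ k * g M.

(* The limit is taken in the extended reals and is required to be a real
   number. *)
Definition is_capacitary_density (g : 'M[R]_(m, d) -> R)
    (psi : 'rV[R]_m -> R) : Prop :=
  forall z : 'rV[R]_m,
    ((ln L ^+ d.-1)%:E * cell_min g L z)%E @[L --> +oo] --> (psi z)%:E.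

End capacity.

(* Main.v *)
Require Import Defs.
From mathcomp Require Import all_boot all_order all_algebra.
From mathcomp Require Import all_classical all_reals all_analysis.
From mathcomp Require Import measurable_realfun ring lra.

Set Implicit Arguments.
Unset Strict Implicit.
Unset Printing Implicit Defensive.

Import Order.TTheory GRing.Theory Num.Theory.
Import numFieldNormedType.Exports.

Local Open Scope classical_set_scope.
Local Open Scope ring_scope.

(* Writing m(L, z) for the infimum [cell_min g L z], the key estimate is
     m(L1 L2, t1 a + t2 b) <= t1^d m(L1, a) + t2^d m(L2, b)   (t1, t2 > 0).
   Given competitors v1 for (L1, a) and v2 for (L2, b), use t1 v1 on Q(L1) and
   t1 a + t2 v2(x / L1) on the rest of Q(L1 L2): the two pieces match because
   v1 = a on the boundary of Q(L1) and v2 = 0 on Q(1), and the energy of the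
   second piece does not feel the dilation since g is homogeneous of degree
   equal to the dimension.  Take t1 = t, t2 = s with t + s = 1, L1 = L^t,
   L2 = L^s and multiply by (log L)^(d-1): as log L1 = t log L, the right-hand
   side becomes t (log L1)^(d-1) m(L1, a) + s (log L2)^(d-1) m(L2, b), and
   L -> +oo gives convexity.

   The gluing needs the gradient in [admissible] to agree almost everywhere
   with the one in [W1p0], and to vanish on Q(1); both follow from the
   fundamental lemma of the calculus of variations. *)

(** * Borel sets and Lebesgue measure on row vectors *)

(** Boundary values are never handled through traces. Up to its boundary value [t1 *: a + t2 *: b],
    the glued competitor is the sum of t1 (v1 - a), extended by zero outside Q(L1), and of t2 (v2(x
    / L1) - b): the first term vanishes outside Q(L1), and the second is the constant -t2 b inside.
    Gluing thus reduces to the stability of W^(1,d)_0 under extension by zero, dilation and sums,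
    each of which is read off the approximating test functions. The weak gradient identity is not
    carried along; it is recovered in the limit from integration by parts for test functions, itself
    a consequence of the translation invariance of Lebesgue measure.

    The gradient whose energy is measured is known only through its weak identity, whereas extension
    and dilation act on the limit of the approximating gradients; this is why the two must be
    compared almost everywhere. For the fundamental lemma, explicit bumps converging to indicators
    of boxes are enough, since open boxes form a generating pi-system. *)

Section measurable_matrix_more.
Context {R : realType}.

Lemma measurable_fun_mx d' (S : measurableType d') m n (D : set S)
    (f : S -> 'M[R]_(m, n)) :
  (forall i j, measurable_fun D (fun x => f x i j)) -> measurable_fun D f.
Proof.
move=> mf mD; apply: (@measurability _ _ _ _ _ _
  (\bigcup_(ij in [set: 'I_m * 'I_n])
     preimage_set_system setT (fun M : 'M[R]_(m, n) => M ij.1 ij.2)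
       measurable)) => //.
move=> _ [_ [[i j] _ [A mA <-]] <-]; rewrite /= !setTI -comp_preimage.
exact: mf.
Qed.

(** The sup-norm balls with rational centre and radius 1/(k+1) are countably many, each is a finite
    intersection of preimages under entries, and an open set is the union of those it contains. *)
Lemma open_measurable_mx m n (U : set 'M[R]_(m, n)) : open U -> measurable U.
Proof.
move=> oU.
pose B (qk : 'M[rat]_(m, n) * nat) : set 'M[R]_(m, n) :=
  \bigcap_(ij in [set: 'I_m * 'I_n]) ((fun M : 'M[R]_(m, n) => M ij.1 ij.2) @^-1`
     ball (ratr (qk.1 ij.1 ij.2) : R) qk.2.+1%:R^-1).
have mB qk : measurable (B qk).
  apply: fin_bigcap_measurable => // ij _.
  rewrite -[X in measurable X]setTI; apply: measurable_mx_entry => //.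
  by apply: open_measurable; exact: ball_open.
have -> : U = \bigcup_(qk in [set qk | B qk `<=` U]) B qk.
  apply/seteqP; split=> [M UM|M [qk /= +]]; last exact.
  have /nbhs_ballP[e /= e0 MeU] := open_nbhs_nbhs (conj oU UM).
  (* Two steps of length 1/(k+1), from M to the rational centre and from there to any point of the
     ball, must stay within [e]. *)
  have [k _ ke] : exists2 k : nat, True & k.+1%:R^-1 < e / 2.
    exists (Num.bound (e / 2)^-1) => //.
    rewrite -[ltRHS]invrK ltf_pV2 ?posrE ?invr_gt0 ?divr_gt0//.
    rewrite (lt_trans (archi_boundP _)) ?invr_ge0 ?divr_ge0 ?ltW// ltr_nat//.
  have /fin_all_exists[q qP] (ij : 'I_m * 'I_n) :
      exists q : rat, ball (ratr q : R) k.+1%:R^-1 (M ij.1 ij.2).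
    have [q] := @rat_in_itvoo R (M ij.1 ij.2 - k.+1%:R^-1)
      (M ij.1 ij.2 + k.+1%:R^-1) ltac:(by rewrite ltrBlDr -addrA ltrDl addr_gt0).
    rewrite in_itv/= => /andP[q1 q2]; exists q.
    by rewrite /ball/= ltr_distl q1 q2.
  exists (\matrix_(i, j) q (i, j), k) => /=; last first.
    by move=> ij _ /=; rewrite mxE; case: ij => i j; exact: qP.
  move=> N /= BN; apply: MeU; split => // i j.
  have /= := BN (i, j) I; rewrite mxE => h1; have /= h2 := qP (i, j).
  apply: (@le_ball _ _ _ (k.+1%:R^-1 + k.+1%:R^-1)); first by rewrite [e]splitr lerD// ltW.
  by apply: ball_triangle h1; exact: ball_sym.
rewrite bigcup_mkcond; apply: countable_bigcupT_measurable => [|qk].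
  exact: countableP.
by case: ifP.
Qed.

Lemma continuous_measurable_mx m n (f : 'M[R]_(m, n) -> R) :
  continuous f -> measurable_fun setT f.
Proof.
move=> /continuousP cf; apply: (measurability _ (RGenOpens.measurableE R)).
move=> _ [_ [a [b ->] <-]]; rewrite setTI; apply: open_measurable_mx.
exact/cf/interval_open.
Qed.

End measurable_matrix_more.

(** * Open boxes as a pi-system, and the change of variables r x + c *)

Section lebesgue_rV_affine.
Context {R : realType}.

Definition open_box n (a b : 'I_n -> R) : set 'rV[R]_n :=
  rV_box (fun i => `]a i, b i[%classic).

Definition open_boxes n : set (set 'rV[R]_n) :=
  [set A | exists a b, A = open_box a b].

Lemma measurable_open_box n (a b : 'I_n -> R) : measurable (open_box a b).
Proof. by apply: measurable_rV_box => i; exact: measurable_itv. Qed.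

Lemma open_boxes_setI n : setI_closed (@open_boxes n).
Proof.
move=> _ _ [a [b ->]] [a' [b' ->]].
exists (fun i => Num.max (a i) (a' i)), (fun i => Num.min (b i) (b' i)).
apply/seteqP; split => [x /= [h1 h2] i|x /= h].
  have := h1 i; have := h2 i; rewrite /= !in_itv/= gt_max lt_min.
  by move=> /andP[-> ->] /andP[-> ->].
split=> i; have := h i; rewrite /= !in_itv/= gt_max lt_min.
  by move=> /andP[/andP[-> _] /andP[-> _]].
by move=> /andP[/andP[_ ->] /andP[_ ->]].
Qed.

Lemma bigcup_open_box n :
  \bigcup_k open_box (fun=> - k%:R) (fun=> k%:R) = [set: 'rV[R]_n].
Proof.
apply/seteqP; split => // x _.
exists (Num.bound (`|x| : R)) => //= i; rewrite /= in_itv/= -ltr_norml.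
have xi : `|x ord0 i| <= `|x|.
  rewrite [leRHS]/Num.Def.normr/= mx_normrE.
  exact: (le_bigmax _ (fun ij => `|x ij.1 ij.2|) (ord0, i)).
by rewrite (le_lt_trans xi)// archi_boundP.
Qed.

(** A half-space M i > x is the increasing union of the boxes with lower bound x in coordinate i and
    -k elsewhere, with upper bounds k; such half-spaces generate. With [open_boxes_setI] this makes
    open boxes usable both for uniqueness of measures and for the fundamental lemma. *)
Lemma measurable_rVE n : @measurable _ 'rV[R]_n = <<s @open_boxes n >>.
Proof.
apply/seteqP; split; last first.
  apply: smallest_sub; first exact: sigma_algebra_measurable.
  by move=> _ [a [b ->]]; exact: measurable_open_box.
apply: smallest_sub; first exact: smallest_sigma_algebra.
move=> _ [[i0 i] _ [A mA <-]]; rewrite /= setTI.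
pose F := [set A : set R | <<s @open_boxes n >>
  ((fun M : 'rV[R]_n => M i0 i) @^-1` A)].
have mAG : <<s @RGenOInfty.G R >> A.
  exact: (eq_ind _ (fun S : set (set R) => S A) mA _ (RGenOInfty.measurableE R)).
suff : <<s @RGenOInfty.G R >> `<=` F by exact.
apply: smallest_sub.
  split; rewrite /F/=.
  - by rewrite preimage_set0; exact: sigma_algebra0.
  - by move=> B FB; rewrite setTD preimage_setC; exact: sigma_algebraC.
  - by move=> B FB; rewrite preimage_bigcup; exact: sigma_algebra_bigcup.
move=> _ [x ->]; rewrite /F/=.
rewrite (_ : _ @^-1` _ = \bigcup_k open_box (fun j => if j == i then x else - k%:R)
    (fun=> k%:R)).
  apply: sigma_algebra_bigcup => k; apply: sub_sigma_algebra.
  by eexists; eexists; reflexivity.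
rewrite (ord1 i0); apply/seteqP; split => [M /=|M [k _ /(_ i)]/=]; last first.
  by rewrite eqxx !in_itv/= andbT => /andP[].
rewrite in_itv/= andbT => xM.
have [k _ /= kM] : (\bigcup_k open_box (fun=> - k%:R) (fun=> k%:R)) M.
  by rewrite bigcup_open_box.
exists k => // j /=; have := kM j; rewrite /= !in_itv/=.
by case: eqVneq => // -> /andP[_ ->]; rewrite xM.
Qed.

Lemma rV_measure_unique n (m1 m2 : {measure set 'rV[R]_n -> \bar R}) :
  (forall a b, m1 (open_box a b) = m2 (open_box a b)) ->
  (forall a b, (m1 (open_box a b) < +oo)%E) ->
  forall A, measurable A -> m1 A = m2 A.
Proof.
move=> m12 m1f; apply: (measure_unique (@open_boxes n)
  (fun k => open_box (fun=> - k%:R) (fun=> k%:R))) => //.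
- exact: measurable_rVE.
- exact: open_boxes_setI.
- by move=> k; eexists; eexists; reflexivity.
- exact: bigcup_open_box.
- by move=> _ [a [b ->]].
Qed.

(** The maximum with 0 covers empty boxes, so that no order between [a] and [b] has to be
    assumed. *)
Lemma lebesgue_rV_open_box n (a b : 'I_n -> R) :
  lebesgue_rV (open_box a b) = (\prod_(i < n) Num.max (b i - a i) 0)%:E.
Proof.
rewrite lebesgue_rV_boxE//.
elim/big_ind2 : _ => //= [x y u v -> ->|i _]; first by rewrite EFinM.
rewrite lebesgue_measure_itv/= lte_fin; case: ltP => ba.
  by rewrite -EFinB; congr EFin; rewrite max_l// subr_ge0 ltW.
by congr EFin; rewrite max_r// subr_le0.
Qed.

Lemma measurable_affine_rV n (r : R) (c : 'rV[R]_n) :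
  measurable_fun setT (fun x : 'rV[R]_n => r *: x + c).
Proof.
apply: measurable_fun_mx => i j; under eq_fun do rewrite !mxE.
apply: measurable_funD => //; apply: measurable_funM => //.
exact: measurable_mx_entry.
Qed.

(** Both sides are measures in [A] that agree on open boxes, where they are finite. The case r = 1
    serves the difference quotients, the case c = 0 the dilation invariance of the energy. *)
Lemma lebesgue_rV_affine n (r : R) (c : 'rV[R]_n) (A : set 'rV[R]_n) : 0 < r ->
  measurable A ->
  lebesgue_rV ((fun x => r *: x + c) @^-1` A) = ((r^-1 ^+ n)%:E * lebesgue_rV A)%E.
Proof.
move=> r0 mA.
have k0 : 0 <= r^-1 ^+ n by rewrite exprn_ge0// invr_ge0 ltW.
pose m1 := pushforward (@lebesgue_rV R n) (fun x => r *: x + c).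
pose m1' : {measure set 'rV[R]_n -> \bar R} :=
  measure_function_pushforward__canonical__measure_function_Measure
  (@lebesgue_rV R n) (@measurable_affine_rV n r c).
pose m2 : {measure set 'rV[R]_n -> \bar R} := mscale (NngNum k0) (@lebesgue_rV R n).
have -> : lebesgue_rV ((fun x => r *: x + c) @^-1` A) = m1' A by [].
have -> : ((r^-1 ^+ n)%:E * lebesgue_rV A)%E = m2 A by [].
have m1E a b : m1' (open_box a b) = (\prod_(i < n) Num.max ((b i - a i) / r) 0)%:E.
  rewrite /m1'/= /pushforward.
  have -> : (fun x => r *: x + c) @^-1` open_box a b =
      open_box (fun i => (a i - c ord0 i) / r) (fun i => (b i - c ord0 i) / r).
    apply/seteqP; split => x /= h i; have := h i; rewrite /= !in_itv/= !mxE.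
      rewrite ltr_pdivrMr// ltr_pdivlMr// => /andP[h1 h2]; apply/andP; split; lra.
    by rewrite ltr_pdivrMr// ltr_pdivlMr// => /andP[h1 h2]; apply/andP; split; lra.
  rewrite lebesgue_rV_open_box; congr EFin; apply: eq_bigr => i _.
  by congr Num.max; ring.
apply: rV_measure_unique => // a b; rewrite m1E ?ltry//.
rewrite /m2/= /mscale/= lebesgue_rV_open_box -EFinM; congr EFin.
rewrite -[X in _ ^+ X]card_ord -prodr_const -big_split/=; apply: eq_bigr => i _.
by rewrite maxr_pMr ?invr_ge0 ?ltW// mulr0 mulrC.
Qed.

Lemma ge0_integral_affine_rV n (r : R) (c : 'rV[R]_n) (D : set 'rV[R]_n)
    (f : 'rV[R]_n -> \bar R) : 0 < r -> measurable D -> measurable_fun D f ->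
  (forall x, D x -> 0 <= f x)%E ->
  (\int[@lebesgue_rV R n]_(x in (fun x => r *: x + c)%R @^-1` D) f (r *: x + c)%R =
   (r^-1 ^+ n)%:E * \int[@lebesgue_rV R n]_(x in D) f x)%E.
Proof.
move=> r0 mD mf f0.
have k0 : 0 <= r^-1 ^+ n by rewrite exprn_ge0// invr_ge0 ltW.
rewrite -[RHS](ge0_integral_mscale _ mD (NngNum k0))//.
have := @ge0_integral_pushforward _ _ _ _ R _ (@measurable_affine_rV n r c)
  (@lebesgue_rV R n) D f mD mf.
move=> <-; last by move=> y /set_mem; exact: f0.
apply: (@eq_measure_integral _ _ _ _ _
  (measure_function_pushforward__canonical__measure_function_Measure
    (@lebesgue_rV R n) (@measurable_affine_rV n r c))) => A mA _.
exact: lebesgue_rV_affine.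
Qed.

End lebesgue_rV_affine.

(** * Integrals of partial derivatives *)

Section integrable_EFin.
Context d (T : measurableType d) (R : realType) (mu : {measure set T -> \bar R}).
Variables (D : set T) (mD : measurable D).
Implicit Types f g : T -> R.

Lemma integrableB_EFin f g : mu.-integrable D (EFin \o f) ->
  mu.-integrable D (EFin \o g) -> mu.-integrable D (EFin \o (fun x => f x - g x)).
Proof. by move=> fi gi; have := integrableB mD fi gi. Qed.

Lemma integrableZ_EFin (k : R) f : mu.-integrable D (EFin \o f) ->
  mu.-integrable D (EFin \o (fun x => k * f x)).
Proof. by move=> fi; have := integrableZl mD k fi. Qed.

Lemma integrable_measurable f : mu.-integrable D (EFin \o f) -> measurable_fun D f.
Proof. by case/integrableP => /measurable_EFinP. Qed.

Lemma Rintegral_dominated_cvg (f_ : nat -> T -> R) f g :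
  (forall n, measurable_fun D (f_ n)) -> measurable_fun D f ->
  (forall x, D x -> f_ n x @[n --> \oo] --> f x) ->
  mu.-integrable D (EFin \o g) -> (forall n x, D x -> `|f_ n x| <= g x) ->
  \int[mu]_(x in D) f_ n x @[n --> \oo] --> \int[mu]_(x in D) f x.
Proof.
move=> mf_ mf f_f gi f_g.
have Ef_f x : D x -> (EFin \o f_ n) x @[n --> \oo] --> (EFin \o f) x.
  by move=> Dx; apply: cvg_EFin; [near=> n|exact: f_f].
have [fi _] := @dominated_convergence _ _ _ mu D mD (fun n => EFin \o f_ n)
  (EFin \o f) (EFin \o g) (fun n => (measurable_EFinP D (f_ n)).2 (mf_ n))
  ((measurable_EFinP D f).2 mf) (aeW _ Ef_f) gi (aeW _ (fun x n Dx => f_g n x Dx)).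
by rewrite -(@fineK _ (integral _ _ _)) ?(integrable_fin_num mD fi)// => /fine_cvg.
Unshelve. all: by end_near. Qed.

End integrable_EFin.

(** * Cubes, and functions vanishing outside them *)

Section cube_lemmas.
Context {R : realType} {d : nat}.
Local Notation mu := (@lebesgue_rV R d).

Lemma cubeE (r : R) : @cube R d r = open_box (fun=> - (r / 2)) (fun=> r / 2).
Proof. by apply/seteqP; split => x /= h i; have := h i; rewrite /= in_itv. Qed.

Lemma measurable_cube (r : R) : measurable (@cube R d r).
Proof. by rewrite cubeE; exact: measurable_open_box. Qed.

Lemma lebesgue_cube_lty (r : R) : (mu (cube r) < +oo)%E.
Proof. by rewrite cubeE lebesgue_rV_open_box ltry. Qed.

Lemma sub_cube (r s : R) : r <= s -> @cube R d r `<=` cube s.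
Proof.
move=> rs x h i; have /andP[h1 h2] := h i.
have rs2 : r / 2 <= s / 2 by rewrite ler_pM2r.
by rewrite (lt_le_trans h2)// andbT (le_lt_trans _ h1)// lerN2.
Qed.

Lemma scale_cube (r s : R) (x : 'rV[R]_d) : 0 < s ->
  cube r (s *: x) <-> cube (r / s) x.
Proof.
move=> s0.
have E i : (- (r / 2) < (s *: x) ord0 i < r / 2) =
    (- (r / s / 2) < x ord0 i < r / s / 2).
  by rewrite mxE (mulrAC r) -(mulNr (r / 2)) (ltr_pdivlMr _ _ s0)
    (ltr_pdivrMr _ _ s0) (mulrC s).
by split => h i; have := h i; rewrite E.
Qed.

Lemma bounded_continuous_cube (h : 'rV[R]_d -> R) (r : R) : continuous h ->
  (forall x, ~ cube r x -> h x = 0) ->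
  exists2 M : R, 0 <= M & forall x, `|h x| <= M.
Proof.
move=> ch h0.
have cK : compact [set x : 'rV[R]_d | forall i : 'I_d,
    `[(- (r / 2)), (r / 2)]%classic (x ord0 i)].
  exact: (@rV_compact R d (fun=> _) (fun=> @segment_compact R _ _)).
have /compact_bounded/pinfty_ex_gt0[M M0 hM] :=
  continuous_compact (continuous_subspaceT ch) cK.
exists M => [|x]; first exact: ltW.
have [xr|/h0->] := pselect (cube r x); last by rewrite normr0 ltW.
apply: hM => /=; exists x => // i /=; rewrite in_itv/=.
by have /andP[/ltW -> /ltW ->] := xr i.
Qed.

Lemma integrable_bounded (D : set 'rV[R]_d) (r M : R) (h : 'rV[R]_d -> R) :
  measurable D -> D `<=` cube r -> measurable_fun D h ->
  (forall x, D x -> `|h x| <= M) -> mu.-integrable D (EFin \o h).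
Proof.
move=> mD Dr mh hM; apply: measurable_bounded_integrable => //.
  by rewrite (le_lt_trans _ (lebesgue_cube_lty r))// le_measure ?inE//; exact: measurable_cube.
exists M; split; first exact: num_real.
by move=> y My x Dx /=; rewrite (le_trans (hM _ Dx))// ltW.
Qed.

Lemma Rintegral_supp (D : set 'rV[R]_d) (h : 'rV[R]_d -> R) :
  (forall x, ~ D x -> h x = 0) ->
  \int[mu]_(x in D) h x = \int[mu]_x h x.
Proof.
move=> h0; rewrite Rintegral_mkcond; congr (Rintegral _ _ _); apply/funext => x.
by rewrite patchE; case: ifPn => // /negP; rewrite inE => /h0.
Qed.

Lemma integrable_supp (D : set 'rV[R]_d) (h : 'rV[R]_d -> R) :
  measurable D -> (forall x, ~ D x -> h x = 0) ->
  mu.-integrable D (EFin \o h) -> mu.-integrable setT (EFin \o h).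
Proof.
move=> mD h0 /(integrable_mkcond _ mD); congr integrable; apply/funext => x.
by rewrite patchE; case: ifPn => // /negP; rewrite inE /= => /h0 ->.
Qed.

End cube_lemmas.

Section partial_derivative.
Context {R : realType} {d : nat}.
Local Notation mu := (@lebesgue_rV R d).
Local Notation e_ j := (delta_mx ord0 j : 'rV[R]_d).
Implicit Types f : 'rV[R]_d -> R.

Lemma is_derive_line f (j : 'I_d) (x : 'rV[R]_d) (t : R) :
  derivable f (x + t *: e_ j) (e_ j) ->
  is_derive t (1 : R) (fun s : R => f (x + s *: e_ j)) (partial j f (x + t *: e_ j)).
Proof.
move=> /derivableP[df dfE].
have E : (fun h : R => h^-1 *: (((fun s : R => f (x + s *: e_ j)) \o shift t) (h *: (1 : R))
      - f (x + t *: e_ j))) =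
    (fun h : R => h^-1 *: ((f \o shift (x + t *: e_ j)) (h *: e_ j) - f (x + t *: e_ j))).
  apply/funext => h /=; congr (_ *: (f _ - _)).
  by rewrite /GRing.scale/= mulr1 -/(GRing.scale _ _) scalerDl addrCA.
split; first by rewrite /derivable E.
by rewrite /partial /derive E.
Qed.

(** Mean value theorem on the line through x in direction e_j. It bounds the difference quotients
    uniformly in the step, which gives the domination in [Rintegral_partial0]. *)
Lemma partial_increment_le f (j : 'I_d) (M : R) :
  (forall x, derivable f x (e_ j)) -> (forall x, `|partial j f x| <= M) ->
  forall x t, 0 < t -> `|f (x + t *: e_ j) - f x| <= M * t.
Proof.
move=> df fM x t t0.
have dg s : is_derive s (1 : R) (fun s : R => f (x + s *: e_ j))
  (partial j f (x + s *: e_ j)) by exact: is_derive_line.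
have cg : continuous (fun s : R => f (x + s *: e_ j)).
  by move=> s; apply: differentiable_continuous; apply/derivable1_diffP; exact: ex_derive.
have [c _] := MVT t0 (fun s _ => dg s) (continuous_subspaceT cg).
rewrite scale0r addr0 subr0 => ->.
by rewrite normrM (gtr0_norm t0) ler_pM2r.
Qed.

(** The change of variables with r = 1 applies to nonnegative functions; the general case is
    obtained from the positive and negative parts. *)
Lemma Rintegral_translate (c : 'rV[R]_d) f :
  mu.-integrable setT (EFin \o f) ->
  mu.-integrable setT (EFin \o (fun x : 'rV[R]_d => f (x + c))) /\
  \int[mu]_x f (x + c) = \int[mu]_x f x.
Proof.
move=> fi; have mf : measurable_fun setT f by exact: integrable_measurable fi.
have shE (g : 'rV[R]_d -> \bar R) : measurable_fun setT g ->
    (forall x, 0 <= g x)%E -> (\int[mu]_x g (x + c)%R = \int[mu]_x g x)%E.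
  move=> mg g0; have := @ge0_integral_affine_rV R d 1 c setT g ltr01 measurableT mg
    (fun x _ => g0 x).
  rewrite preimage_setT invr1 expr1n mul1e => <-.
  by apply: eq_integral => x _; rewrite scale1r.
have mfc : measurable_fun setT (fun x : 'rV[R]_d => f (x + c)).
  apply: (measurableT_comp mf); have := @measurable_affine_rV R d 1 c.
  by apply: eq_measurable_fun => x _; rewrite scale1r.
split.
  apply/integrableP; split; first exact/measurable_EFinP.
  have := shE (fun x => `|(f x)%:E|%E); rewrite /= => ->//.
    by have /integrableP[] := fi.
  by apply/measurable_EFinP; exact: measurableT_comp.
congr fine; rewrite integralE [RHS]integralE.
have mEf : measurable_fun setT (EFin \o f) by exact/measurable_EFinP.
congr (_ - _)%E.
  rewrite -(shE _ (measurable_funepos mEf) (funepos_ge0 _)).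
  by apply: eq_integral => x _; rewrite !funeposE.
rewrite -(shE _ (measurable_funeneg mEf) (funeneg_ge0 _)).
by apply: eq_integral => x _; rewrite !funenegE.
Qed.

(* By translation invariance the difference quotients have zero integral. *)
Lemma Rintegral_partial0 f (j : 'I_d) (r : R) :
  continuous f -> (forall x, derivable f x (e_ j)) -> continuous (partial j f) ->
  (forall x, ~ cube r x -> f x = 0) -> (forall x, ~ cube r x -> partial j f x = 0) ->
  \int[mu]_x partial j f x = 0.
Proof.
move=> cf df cdf f0 df0.
have [M M0 fM] := bounded_continuous_cube cf f0.
have [N N0 dfN] := bounded_continuous_cube cdf df0.
have fi : mu.-integrable setT (EFin \o f).
  apply: (integrable_supp (measurable_cube r)) => //.
  apply: (integrable_bounded (measurable_cube r) (@subset_refl _ _)) => //.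
  by apply: measurable_funTS; exact: continuous_measurable_mx.
pose q (n : nat) (x : 'rV[R]_d) : R := n.+1%:R * (f (x + n.+1%:R^-1 *: e_ j) - f x).
have mfq n : measurable_fun setT (q n).
  apply: measurable_funM => //; apply: measurable_funB.
    by have [/integrable_measurable] := Rintegral_translate (n.+1%:R^-1 *: e_ j) fi.
  exact: continuous_measurable_mx.
have q0 n : \int[mu]_x q n x = 0.
  have [fci fcE] := Rintegral_translate (n.+1%:R^-1 *: e_ j) fi.
  rewrite RintegralZl//; last exact: integrableB_EFin.
  by rewrite RintegralB// fcE subrr mulr0.
have qcvg x : q n x @[n --> \oo] --> partial j f x.
  have dfx : h^-1 *: ((f \o shift x) (h *: e_ j) - f x) @[h --> 0^'] --> partial j f x.
    by have := df x; rewrite /derivable /partial /derive.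
  have : (fun n : nat => n.+1%:R^-1 : R) @ \oo --> 0^'.
    move=> A /(@cvg_harmonic R)[K _ KA]; exists K => // n /KA /=; apply.
    by rewrite invr_neq0.
  move=> /(cvg_comp _ _) /(_ dfx); apply: cvg_trans; apply: near_eq_cvg.
  by near=> n; rewrite /q/= invrK (addrC _ x).
(* The steps 1/(n+1) are at most 1, and passing from side r to side r + 2 adds 1 on each side:
   outside the larger cube both values in the quotient vanish. *)
have qbd n x : `|q n x| <= N * \1_(cube (r + 2)) x.
  rewrite indicE; have [xr|/negP] := boolP (x \in cube (r + 2)).
    rewrite mulr1 /q normrM ger0_norm//.
    rewrite -ler_pdivlMl//; rewrite mulrC.
    exact: partial_increment_le.
  rewrite inE => xr; rewrite mulr0 /q f0 ?f0 ?subrr ?mulr0 ?normr0//.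
    by apply: contra_not xr; apply: sub_cube; rewrite lerDl.
  apply: contra_not xr => h i; have /andP[] := h i; rewrite !mxE eqxx/=.
  have n0 : 0 <= n.+1%:R^-1 * (i == j)%:R :> R by rewrite mulr_ge0.
  have n1 : n.+1%:R^-1 * (i == j)%:R <= 1 :> R.
    by rewrite -[leRHS]mulr1 ler_pM// ?invf_le1 ?ler1n// lern1 leq_b1.
  move: n0 n1; move: (_ * (i == j)%:R) => u u0 u1 h1 h2.
  by apply/andP; split; lra.
have gi : mu.-integrable setT (EFin \o (fun x => N * \1_(cube (r + 2)) x)).
  apply: integrableZ_EFin => //; apply: (integrable_supp (measurable_cube (r + 2))).
    by move=> x /= xr; rewrite indicE memNset.
  apply: (integrable_bounded (M := 1) (measurable_cube _) (@subset_refl _ _)) => [|x _].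
    exact: measurable_indic (measurable_cube _).
  by rewrite indicE ger0_norm//; case: (_ \in _).
have := Rintegral_dominated_cvg measurableT mfq (continuous_measurable_mx cdf)
  (fun x _ => qcvg x) gi (fun n x _ => qbd n x).
under eq_fun do rewrite q0.
by move=> /cvg_lim <-//; rewrite lim_cst.
Unshelve. all: by end_near. Qed.

End partial_derivative.

(** * Test functions *)

Section test_functions.
Context {R : realType} {d : nat}.
Local Notation mu := (@lebesgue_rV R d).
Local Notation e_ j := (delta_mx ord0 j : 'rV[R]_d).
Implicit Types (f phi psi : 'rV[R]_d -> R) (D : set 'rV[R]_d).

Lemma near_nsupp f x : ~ supp f x -> \forall y \near x, f y = 0.
Proof.
move=> nfx; have /open_nbhs_nbhs : open_nbhs x (~` supp f).
  by split => //; apply: closed_openC; exact: closed_closure.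
apply: filterS => y /= ny; apply: contrapT => fy; apply: ny.
by apply: subset_closure => /=; exact/eqP.
Qed.

Lemma nsupp_eq0 f x : ~ supp f x -> f x = 0.
Proof. by move=> /near_nsupp/nbhs_singleton. Qed.

Lemma nsupp_partial0 f (j : 'I_d) x : ~ supp f x -> partial j f x = 0.
Proof.
by move=> /near_nsupp fx; rewrite /partial (@near_eq_derive _ _ _ f (cst 0))// derive_cst.
Qed.

Lemma smooth_continuous f : smooth f -> continuous f.
Proof. by move=> /(_ [::])[]. Qed.

Lemma smooth_derivable f : smooth f -> forall j x, derivable f x (e_ j).
Proof. by move=> /(_ [::])[]. Qed.

Lemma smooth_continuous_partial f j : smooth f -> continuous (partial j f).
Proof. by move=> /(_ [:: j])[]. Qed.

Lemma iter_partialD f g s : smooth f -> smooth g ->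
  iter_partial s (fun x => f x + g x) =
  (fun x => iter_partial s f x + iter_partial s g x).
Proof.
move=> sf sg; elim: s => //= j s ->; apply/funext => x.
rewrite /partial deriveD//; [have [_] := sf s|have [_] := sg s]; exact.
Qed.

Lemma smoothD f g : smooth f -> smooth g -> smooth (fun x => f x + g x).
Proof.
move=> sf sg s; rewrite iter_partialD//.
have [cf df] := sf s; have [cg dg] := sg s; split => [x|j x].
  by apply: continuousD; [exact: cf|exact: cg].
by apply: derivableD; [exact: df|exact: dg].
Qed.

Lemma continuous_dilate f (c r : R) : continuous f ->
  continuous (fun x : 'rV[R]_d => c * f (r *: x)).
Proof.
move=> cf; have fr (x : 'rV[R]_d) : f (r *: y) @[y --> x] --> f (r *: x).
  exact: (@cvg_comp _ _ _ ( *:%R r) f _ _ _ (@scaler_continuous _ _ r x) (cf _)).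
by move=> x; exact: (@cvgM _ _ _ _ (fun=> c) _ _ _ (cvg_cst _) (fr x)).
Qed.

Lemma is_derive_dilate f (c r : R) (v x : 'rV[R]_d) : derivable f (r *: x) v ->
  is_derive x v (fun y => c * f (r *: y)) (c * r * 'D_v f (r *: x)).
Proof.
(* The substitution of r h for h preserves the punctured neighbourhoods of 0 only when r is nonzero;
   for r = 0 the function is constant. *)
move=> df; have [->|r0] := eqVneq r 0.
  rewrite mulr0 mul0r; under eq_fun do rewrite scale0r.
  exact: is_derive_cst.
have H : h^-1 *: (((fun y => c * f (r *: y)) \o shift x) (h *: v) - c * f (r *: x))
    @[h --> 0^'] --> c * r * 'D_v f (r *: x).
  have E : (fun h : R => h^-1 *: (((fun y => c * f (r *: y)) \o shift x) (h *: v)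
      - c * f (r *: x))) =
    (fun h : R => c * r *
      ((r * h)^-1 *: ((f \o shift (r *: x)) ((r * h) *: v) - f (r *: x)))).
    apply/funext => h; rewrite [LHS]/= [RHS]/= (scalerDr r) (scalerA r).
    move: (f _) (f _) => a b; rewrite /GRing.scale/= invfM -mulrBr.
    by rewrite -!mulrA mulVKf// mulrCA.
  rewrite E; apply: cvgM; first exact: cvg_cst.
  have rc : (r * h) @[h --> (0 : R)^'] --> (0 : R)^'.
    move=> A [e /= e0 eA]; exists (e / `|r|) => [|h /= he h0].
      by rewrite /= divr_gt0// normr_gt0.
    apply: eA; last by rewrite mulf_neq0.
    by move: he; rewrite /= !sub0r !normrN normrM ltr_pdivlMr ?normr_gt0// mulrC.
  have := df; rewrite /derivable -/('D_v f (r *: x)) => dfl.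
  exact: (@cvg_comp _ _ _ (fun h : R => r * h) _ _ _ _ rc dfl).
by split; [apply: cvgP; exact: H|apply: cvg_lim => //; exact: H].
Qed.

Lemma iter_partial_dilate f (c r : R) s : smooth f ->
  iter_partial s (fun x => c * f (r *: x)) =
  (fun x => c * r ^+ size s * iter_partial s f (r *: x)).
Proof.
move=> sf; elim: s => [|j s /= ->] /=.
  by apply/funext => x; rewrite mulr1.
apply/funext => x; have [_ /(_ j (r *: x)) df] := sf s.
have [_] := is_derive_dilate (c * r ^+ size s) df.
by rewrite /partial => ->; rewrite exprSr mulrA.
Qed.

Lemma smooth_dilate f (c r : R) : smooth f -> smooth (fun x => c * f (r *: x)).
Proof.
move=> sf s; rewrite iter_partial_dilate//; have [cf df] := sf s; split => [|j x].
  exact: continuous_dilate.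
by have [] := is_derive_dilate (c * r ^+ size s) (df j (r *: x)).
Qed.

Lemma compact_supp_sub f (K : set 'rV[R]_d) : compact K ->
  [set x | f x != 0] `<=` K -> compact (supp f) /\ supp f `<=` K.
Proof.
move=> cK fK; have sK : supp f `<=` K.
  rewrite /supp closureE; apply: smallest_sub => //.
  by apply: compact_closed => //; exact: norm_hausdorff.
split => //; apply: subclosed_compact cK sK; exact: closed_closure.
Qed.

Lemma test_functionS D D' phi : D `<=` D' -> test_function D phi -> test_function D' phi.
Proof. by move=> DD' [? ? sD]; split => //; exact: subset_trans sD DD'. Qed.

Lemma test_functionD D phi psi : test_function D phi -> test_function D psi ->
  test_function D (fun x => phi x + psi x).
Proof.
move=> [s1 c1 D1] [s2 c2 D2].
have [cs sD] : compact (supp (fun x => phi x + psi x)) /\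
    supp (fun x => phi x + psi x) `<=` supp phi `|` supp psi.
  apply: compact_supp_sub; first exact: compactU.
  move=> x /= x0; apply: contrapT => /not_orP[/nsupp_eq0 h1 /nsupp_eq0 h2].
  by move: x0; rewrite h1 h2 addr0 eqxx.
split; [exact: smoothD|exact: cs|apply: (subset_trans sD) => x [/D1|/D2]//].
Qed.

Lemma test_function_dilate D D' (c r : R) phi : r != 0 ->
  (forall x, D (r *: x) -> D' x) -> test_function D phi ->
  test_function D' (fun x => c * phi (r *: x)).
Proof.
move=> r0 DD' [s1 c1 D1].
have [cs sD] : compact (supp (fun x => c * phi (r *: x))) /\
    supp (fun x => c * phi (r *: x)) `<=` ( *:%R r^-1) @` supp phi.
  apply: compact_supp_sub.
    apply: continuous_compact => //; apply: continuous_subspaceT.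
    exact: scaler_continuous.
  move=> x /= x0; exists (r *: x); last by rewrite scalerA mulVf// scale1r.
  by apply: contrapT => /nsupp_eq0 h; move: x0; rewrite h mulr0 eqxx.
split; [exact: smooth_dilate|exact: cs|apply: (subset_trans sD) => _ [y /D1 Dy <-]].
by apply: DD'; rewrite scalerA mulfV// scale1r.
Qed.

Lemma test_function_eq0 D phi x : test_function D phi -> ~ D x -> phi x = 0.
Proof. by move=> [_ _ sD] Dx; apply: nsupp_eq0 => /sD. Qed.

Lemma test_function_partial0 D phi j x : test_function D phi -> ~ D x ->
  partial j phi x = 0.
Proof. by move=> [_ _ sD] Dx; apply: nsupp_partial0 => /sD. Qed.

Lemma test_function_integrable D phi r : measurable D -> D `<=` cube r ->
  test_function D phi -> mu.-integrable D (EFin \o phi).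
Proof.
move=> mD Dr tphi; have [/smooth_continuous cphi _ _] := tphi.
have [x /(contra_not (Dr x)) Dx|M _ phiM] := @bounded_continuous_cube _ _ phi r cphi.
  exact: test_function_eq0 tphi Dx.
apply: (integrable_bounded (M := M) mD Dr) => //.
by apply: measurable_funTS; exact: continuous_measurable_mx.
Qed.

Lemma Rintegral_test_partial0 D phi j r : D `<=` cube r -> test_function D phi ->
  \int[mu]_(x in D) partial j phi x = 0.
Proof.
move=> Dr tphi; have [sphi _ _] := tphi.
rewrite Rintegral_supp => [|x]; last exact: test_function_partial0.
apply: (Rintegral_partial0 (r := r)).
- exact: smooth_continuous.
- exact: smooth_derivable.
- exact: smooth_continuous_partial.
- by move=> x /(contra_not (Dr x)); exact: test_function_eq0.
- by move=> x /(contra_not (Dr x)); exact: test_function_partial0.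
Qed.

(** The product of the two functions is C^1 and vanishes outside the cube, so its partial derivative
    has zero integral; the product rule splits that integral. *)
Lemma Rintegral_test_by_parts D phi psi j r : measurable D -> D `<=` cube r ->
  test_function D phi -> test_function D psi ->
  \int[mu]_(x in D) (phi x * partial j psi x) =
  - \int[mu]_(x in D) (partial j phi x * psi x).
Proof.
move=> mD Dr tphi tpsi; have [sphi _ _] := tphi; have [spsi _ _] := tpsi.
have pE : partial j (phi * psi) =
    (fun x => phi x * partial j psi x + psi x * partial j phi x).
  apply/funext => x; rewrite /partial deriveM//; exact: smooth_derivable.
have c1 : continuous (fun x => phi x * partial j psi x).
  move=> x; apply: continuousM; first exact: smooth_continuous.
  exact: smooth_continuous_partial.
have c2 : continuous (fun x => psi x * partial j phi x).
  move=> x; apply: continuousM; first exact: smooth_continuous.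
  exact: smooth_continuous_partial.
have phi0 x : ~ D x -> phi x = 0 by exact: test_function_eq0.
have psi0 x : ~ D x -> psi x = 0 by exact: test_function_eq0.
have intc f : continuous f -> (forall x, ~ D x -> f x = 0) ->
    mu.-integrable D (EFin \o f).
  move=> cf f0; have [x /(contra_not (Dr x))|M _ fM] :=
    @bounded_continuous_cube _ _ f r cf; first exact: f0.
  apply: (integrable_bounded (M := M) mD Dr) => //.
  by apply: measurable_funTS; exact: continuous_measurable_mx.
have : \int[mu]_x partial j (phi * psi) x = 0.
  apply: (Rintegral_partial0 (r := r)).
  - by move=> x; apply: continuousM; exact: smooth_continuous.
  - by move=> x; apply: derivableM; exact: smooth_derivable.
  - by rewrite pE; exact: (fun x => @continuousD _ _ _ _ _ _ (c1 x) (c2 x)).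
  - by move=> x /(contra_not (Dr x))/phi0 h; rewrite /GRing.mul/= h mul0r.
  - by move=> x /(contra_not (Dr x)) Dx; rewrite pE phi0// psi0// !mul0r addr0.
rewrite -(Rintegral_supp (D := D)); last first.
  by move=> x Dx; rewrite pE phi0// psi0// !mul0r addr0.
rewrite pE RintegralD//; first last.
- by apply: intc => // x Dx; rewrite psi0// mul0r.
- by apply: intc => // x Dx; rewrite phi0// mul0r.
move=> /eqP; rewrite addr_eq0 => /eqP ->; congr (- _).
by apply: eq_Rintegral => x _; rewrite mulrC.
Qed.

End test_functions.

(** * A smooth bump function on a box *)

Section flat_functions.
Context {R : realType}.
Implicit Types (W P Q : {poly R}) (t : R).

(** Invert e^x >= 1 + x^n / n! at x = 1/w, n = k + 1. *)
Lemma expRN_inv_le (w : R) k : 0 < w -> expR (- w^-1) <= (k.+1)`!%:R * w ^+ k.+1.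
Proof.
move=> w0; have wi : 0 <= w^-1 by rewrite invr_ge0 ltW.
have f0 : 0 < (k.+1)`!%:R :> R by rewrite ltr0n fact_gt0.
rewrite expRN -[leRHS]invrK lef_pV2 ?posrE ?invr_gt0 ?mulr_gt0 ?expR_gt0 ?exprn_gt0//.
apply: (le_trans _ (expR_ge1Dxn k wi)).
by rewrite invfM exprVn mulrC lerDr ler01.
Qed.

(* This class of functions is closed under differentiation, see
   [is_derive_flat]; hence products of such functions are smooth. *)
Definition flat W P k t : R :=
  if 0 < W.[t] then P.[t] / W.[t] ^+ k * expR (- W.[t]^-1) else 0.

Lemma flat_ge0 W t : 0 <= flat W 1 0 t.
Proof. by rewrite /flat; case: ifP => // _; rewrite hornerC divr1 mul1r expR_ge0. Qed.

Lemma flat_le1 W t : flat W 1 0 t <= 1.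
Proof.
rewrite /flat; case: ifP => // w0; rewrite hornerC divr1 mul1r -expR0 ler_expR.
by rewrite oppr_le0 invr_ge0 ltW.
Qed.

(** Differentiating P W^(-k) exp(-1/W) gives P' / W^k - k P W' / W^(k+1) + P W' / W^(k+2), all times
    the exponential; this is the numerator over the common denominator W^(k+2). *)
Definition flat_deriv W P k : {poly R} :=
  P^`() * W ^+ 2 - k%:R *: (P * W^`() * W) + P * W^`().

Lemma is_derive_flat W P k t :
  is_derive t (1 : R) (flat W P k) (flat W (flat_deriv W P k) k.+2 t).
Proof.
have cW : continuous (horner W) by exact: continuous_horner.
have [w0|w0|w0] := ltgtP W.[t] 0.
- rewrite {2}/flat ltNge (ltW w0)/=.
  have near0 : \forall s \near t, cst 0 s = flat W P k s.
    near=> s; rewrite /flat/= ltNge ltW//.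
    by near: s; have := cW t; move=> /(_ [set x | x < 0]); apply; exact: lt_nbhsl.
  by apply: near_eq_is_derive near0 _; exact: is_derive_cst.
- rewrite {2}/flat w0.
  have nearE : \forall s \near t,
      ((horner P * (fun s => (W.[s])^-1) ^+ k) * (expR \o (fun s => - (W.[s])^-1))) s
      = flat W P k s.
    near=> s; suff ws : 0 < W.[s] by rewrite /flat ws !fctE/= exprVn.
    by near: s; have := cW t; move=> /(_ [set x | 0 < x]); apply; exact: lt_nbhsr.
  apply: near_eq_is_derive nearE _.
  have dW : is_derive t (1 : R) (fun s => (W.[s])^-1) (- W.[t] ^- 2 *: W^`().[t]).
    by apply: is_deriveV; exact: lt0r_neq0.
  have dE : is_derive t (1 : R) (expR \o (fun s => - (W.[s])^-1))
      (expR (- (W.[t])^-1) * - (- W.[t] ^- 2 *: W^`().[t])).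
    exact: is_derive1_comp.
  have dP : is_derive t (1 : R) (horner P) P^`().[t] by exact: is_derive_poly.
  have dWk := is_deriveX k dW.
  apply: is_derive_eq (is_deriveM (is_deriveM dP dWk) dE) _.
  rewrite /flat_deriv /GRing.scale/= !hornerE/=.
  have W0 := lt0r_neq0 w0.
  rewrite !fctE !exprVn; case: k {dWk} => [|k] /=.
    by rewrite !expr0; field.
  by rewrite !exprS; field; rewrite W0/= expf_neq0.
- (* Here W = Q (X - t), and [expRN_inv_le] bounds the difference quotient at z
     by a polynomial multiple of |z - t|. *)
  rewrite {2}/flat w0 ltxx; apply/is_derive1_caratheodory.
  have /factor_theorem[Q WQ] : root W t by rewrite /root w0.
  (* The bound is used with exponent k + 2: k powers of W cancel the pole, and the remaining two
     supply (z - t)^2, of which one factor survives the division by z - t. The slope function below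
     takes the value 0 / 0 = 0 at z = t, which is the derivative sought. *)
  pose K : R := (k.+2)`!%:R.
  exists (fun z => flat W P k z / (z - t)); split; last 2 first.
  + have b z : `|flat W P k z / (z - t)| <= K * `|(P * Q ^+ 2 * ('X - t%:P)).[z]|.
      rewrite /flat; case: ifPn => wz; last by rewrite mul0r normr0 mulr_ge0.
      have zt : z - t != 0.
        apply: contraTneq wz; rewrite WQ !hornerE => ->.
        by rewrite mulr0 ltxx.
      have WzE : W.[z] = Q.[z] * (z - t) by rewrite WQ !hornerE.
      have WzE2 : `|W.[z]| ^+ 2 = `|Q.[z]| ^+ 2 * `|z - t| ^+ 2.
        by rewrite WzE normrM exprMn.
      rewrite !hornerE !normrM !normfV normrX (gtr0_norm wz).
      rewrite (gtr0_norm (expR_gt0 _)) ler_pdivrMr ?normr_gt0//.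
      have := expRN_inv_le k.+1 wz; rewrite -/K => h.
      apply: (@le_trans _ _ (`|P.[z]| / W.[z] ^+ k * (K * W.[z] ^+ k.+2))).
        by rewrite ler_wpM2l// divr_ge0// exprn_ge0// ltW.
      rewrite -[k.+2]addn2 exprD -(gtr0_norm wz) WzE2.
      have : `|W.[z]| ^+ k != 0 by rewrite expf_neq0// normr_eq0 lt0r_neq0.
      move: (`|W.[z]| ^+ k) => u u0; rewrite le_eqVlt; apply/orP; left; apply/eqP.
      by field.
    rewrite /prop_for /continuous_at [X in _ --> X](_ : _ = 0); last first.
      by rewrite subrr invr0 mulr0.
    have cR : continuous (fun z => K * `|(P * Q ^+ 2 * ('X - t%:P)).[z]|).
      move=> z; apply: cvgM; first exact: cvg_cst.
      by apply: cvg_norm; exact: continuous_horner.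
    apply/norm_cvg0P.
    apply: (@squeeze_cvgr _ _ _ _ (cst 0) (fun z => K * `|(P * Q ^+ 2 * ('X - t%:P)).[z]|)).
    * by near=> z; rewrite normr_ge0 b.
    * exact: cvg_cst.
    * have := cR t; rewrite /continuous_at !hornerE subrr mulr0 normr0 mulr0.
      exact.
  + by rewrite subrr invr0 mulr0.
  + move=> z; have -> : flat W P k t = 0 by rewrite /flat w0 ltxx.
    rewrite subr0; have [->|zt] := eqVneq z t.
      by rewrite subrr mulr0 /flat w0 ltxx.
    by rewrite mulfVK// subr_eq0.
Unshelve. all: by end_near. Qed.

End flat_functions.

Section flat_products.
Context {R : realType} {d : nat}.
Local Notation e_ j := (delta_mx ord0 j : 'rV[R]_d).
Variable W : 'I_d -> {poly R}.
Implicit Types (P : 'I_d -> {poly R} * nat).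

Definition flat_prod P (x : 'rV[R]_d) : R :=
  \prod_(i < d) flat (W i) (P i).1 (P i).2 (x ord0 i).

Definition flat_prod_deriv P (j : 'I_d) : 'I_d -> {poly R} * nat :=
  fun i => if i == j then (flat_deriv (W i) (P i).1 (P i).2, (P i).2.+2) else P i.

Lemma is_derive_flat_prod P j (x : 'rV[R]_d) :
  is_derive x (e_ j) (flat_prod P) (flat_prod (flat_prod_deriv P j) x).
Proof.
pose c := \prod_(i < d | i != j) flat (W i) (P i).1 (P i).2 (x ord0 i).
pose F := flat (W j) (P j).1 (P j).2.
have pE : flat_prod (flat_prod_deriv P j) x =
    c * flat (W j) (flat_deriv (W j) (P j).1 (P j).2) (P j).2.+2 (x ord0 j).
  rewrite /flat_prod (bigD1 j)//= /flat_prod_deriv eqxx mulrC; congr (_ * _).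
  by apply: eq_bigr => i /negbTE ->.
have E : (fun h : R => h^-1 *: ((flat_prod P \o shift x) (h *: e_ j) - flat_prod P x)) =
    (fun h : R => c * (h^-1 *: ((F \o shift (x ord0 j)) (h *: 1) - F (x ord0 j)))).
  apply/funext => h /=; rewrite /flat_prod (bigD1 j)//= [in X in _ - X](bigD1 j)//=.
  rewrite !mxE !eqxx mulr1.
  rewrite (eq_bigr (fun i => flat (W i) (P i).1 (P i).2 (x ord0 i))); last first.
    by move=> i /negbTE ij; rewrite !mxE ij andbF mulr0 add0r.
  rewrite -/c -/F [h *: 1]/GRing.scale/= mulr1 /GRing.scale/= -mulrBl.
  by rewrite mulrA mulrC.
have H : h^-1 *: ((flat_prod P \o shift x) (h *: e_ j) - flat_prod P x) @[h --> 0^']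
    --> flat_prod (flat_prod_deriv P j) x.
  rewrite E pE; apply: cvgM; first exact: cvg_cst.
  have [dF <-] := is_derive_flat (W j) (P j).1 (P j).2 (x ord0 j).
  exact: dF.
by split; [apply: cvgP; exact: H|apply: cvg_lim => //; exact: H].
Qed.

(** Differentiation in x_j alters only the factor j and keeps it a flat function, so smoothness of
    all orders comes down to continuity and derivability of one such product. *)
Lemma iter_partial_flat_prod P s : exists P', iter_partial s (flat_prod P) = flat_prod P'.
Proof.
elim: s => [|j s [P' /= ->]]; first by exists P.
exists (flat_prod_deriv P' j); apply/funext => x.
by have [_] := is_derive_flat_prod P' j x.
Qed.

Lemma continuous_flat_prod P : continuous (flat_prod P).
Proof.
suff H (x : 'rV[R]_d) : flat_prod P y @[y --> x] --> flat_prod P x by exact: H.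
refine (@cvg_big R 'I_d *%R 1 xpredT (@mul_continuous R) 'rV[R]_d (nbhs x) _
  (fun i y => flat (W i) (P i).1 (P i).2 (y ord0 i)) _ _ (fun i _ => _)).
apply: (@cvg_comp _ _ _ (fun y : 'rV[R]_d => y ord0 i) (flat (W i) (P i).1 (P i).2)).
  exact: coord_continuous.
apply: differentiable_continuous; apply/derivable1_diffP.
by have [] := is_derive_flat (W i) (P i).1 (P i).2 (x ord0 i).
Qed.

Lemma smooth_flat_prod P : smooth (flat_prod P).
Proof.
move=> s; have [P' ->] := iter_partial_flat_prod P s; split.
  exact: continuous_flat_prod.
by move=> j x; have [] := is_derive_flat_prod P' j x.
Qed.

End flat_products.

(** * The fundamental lemma of the calculus of variations *)

Section bump.
Context {R : realType} {d : nat}.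
Variables a b : 'I_d -> R.

(** The term -1 confines the set where the polynomial is positive to a compact part of the interval,
    which makes the support compact; the factor n + 1 drives the value to +oo at each interior
    point, where exp(-1/W) then tends to 1. *)
Definition bump_poly n i : {poly R} :=
  n.+1%:R *: (('X - (a i)%:P) * ((b i)%:P - 'X)) - 1.

Lemma bump_polyE n i t : (bump_poly n i).[t] = n.+1%:R * ((t - a i) * (b i - t)) - 1.
Proof. by rewrite /bump_poly !hornerE. Qed.

Definition bump n : 'rV[R]_d -> R := flat_prod (bump_poly n) (fun=> (1, 0%N)).

Lemma bump_ge0 n x : 0 <= bump n x.
Proof. by apply: prodr_ge0 => i _; exact: flat_ge0. Qed.

Lemma bump_le1 n x : bump n x <= 1.
Proof. by apply: prodr_ile1 => i _; rewrite flat_ge0 flat_le1. Qed.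

Lemma bump_cvg x : (forall i, a i < b i) ->
  bump n x @[n --> \oo] --> (\1_(open_box a b) x : R).
Proof.
move=> ab; rewrite indicE; have [|/negP] := boolP (x \in open_box a b); rewrite inE => xab.
  have -> : true%:R = \prod_(i < d) (1 : R) by rewrite big1.
  refine (@cvg_big R 'I_d *%R 1 xpredT (@mul_continuous R) nat \oo%classic _
    (fun i n => flat (bump_poly n i) 1 0 (x ord0 i)) _ _ (fun i _ => _)).
  have := xab i; rewrite /= in_itv/= => /andP[ax xb].
  pose c := (x ord0 i - a i) * (b i - x ord0 i).
  have c0 : 0 < c by rewrite mulr_gt0// subr_gt0.
  have wc : (n.+1%:R * c - 1)^-1 @[n --> \oo] --> (0 : R).
    have -> : (fun n => (n.+1%:R * c - 1)^-1) = (fun n => n.+1%:R^-1 * (c - n.+1%:R^-1)^-1 : R).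
      apply/funext => n; rewrite -invfM mulrBr mulfV//.
    rewrite -(mul0r (c - 0)^-1); apply: cvgM; first exact: cvg_harmonic.
    apply: cvgV; first by rewrite subr0 gt_eqF.
    by apply: cvgB; [exact: cvg_cst|exact: cvg_harmonic].
  have : expR (- (n.+1%:R * c - 1)^-1) @[n --> \oo] --> (1 : R).
    rewrite -[X in _ --> X]expR0 -oppr0.
    apply: continuous_cvg; first exact: continuous_expR.
    exact: cvgN.
  apply: cvg_trans; apply: near_eq_cvg; near=> n.
  rewrite /flat bump_polyE -/c hornerC divr1 mul1r ifT//.
  rewrite subr_gt0 -ltr_pdivrMr// mul1r (lt_trans (archi_boundP _)) ?invr_ge0 ?ltW//.
  rewrite ltr_nat ltnS; near: n; exact: nbhs_infty_ge.
have bump0 n : bump n x = 0.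
  have /existsNP[i xi] := xab.
  apply/eqP; rewrite /bump /flat_prod prodf_seq_eq0; apply/hasP; exists i => //=.
    by rewrite mem_index_enum.
  rewrite /flat bump_polyE ifF//; apply/negP; rewrite subr_gt0 => h.
  apply: xi; rewrite /= in_itv/=.
  have : 0 < (x ord0 i - a i) * (b i - x ord0 i).
    by rewrite -(pmulr_rgt0 _ (ltr0Sn R n)) (lt_trans ltr01).
  (* The two factors cannot both be negative: x i <= a i < b i already makes the second one
     positive. *)
  have [ax|xa] := ltP (a i) (x ord0 i); first by rewrite pmulr_rgt0 ?subr_gt0.
  have xb : 0 < b i - x ord0 i by rewrite subr_gt0 (le_lt_trans xa).
  by rewrite pmulr_lgt0// subr_gt0 ltNge xa.
under eq_fun do rewrite bump0.
exact: cvg_cst.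
Unshelve. all: by end_near. Qed.

Lemma test_function_bump n : (forall i, a i < b i) ->
  test_function (open_box a b) (bump n).
Proof.
(* If u + v = b i - a i with u, v positive and (n+1) u v > 1, then v < b i - a i forces u > 1 /
   ((n+1) (b i - a i)). This is applied to the distances from x i to both endpoints. *)
move=> ab; pose del i : R := (n.+1%:R * (b i - a i))^-1.
have del0 i : 0 < del i by rewrite invr_gt0 mulr_gt0// subr_gt0.
pose K : set 'rV[R]_d :=
  [set x | forall i : 'I_d, `[a i + del i, b i - del i]%classic (x ord0 i)].
have cK : compact K by exact: (@rV_compact R d (fun=> _) (fun=> @segment_compact R _ _)).
have [cs sK] : compact (supp (bump n)) /\ supp (bump n) `<=` K.
  apply: compact_supp_sub cK _ => x /= bx i /=; rewrite in_itv/=.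
  have : 0 < (bump_poly n i).[x ord0 i].
    apply: contraNT bx => w0; rewrite /bump /flat_prod prodf_seq_eq0.
    by apply/hasP; exists i; rewrite ?mem_index_enum//= /flat (negbTE w0).
  rewrite bump_polyE subr_gt0 => h.
  have h0 : 0 < (x ord0 i - a i) * (b i - x ord0 i).
    by rewrite -(pmulr_rgt0 _ (ltr0Sn R n)) (lt_trans ltr01).
  have [ax xb] : a i < x ord0 i /\ x ord0 i < b i.
    have [ax|xa] := ltP (a i) (x ord0 i).
      by split => //; move: h0; rewrite pmulr_rgt0 ?subr_gt0.
    have xb : 0 < b i - x ord0 i by rewrite subr_gt0 (le_lt_trans xa).
    by move: h0; rewrite pmulr_lgt0// subr_gt0 ltNge xa.
  have aux (u v : R) : 0 < u -> 0 < v -> u + v = b i - a i ->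
      1 < n.+1%:R * (u * v) -> del i <= u.
    move=> u0 v0 uv huv; rewrite /del -[leLHS]mul1r ler_pdivrMr ?mulr_gt0 ?subr_gt0//.
    rewrite (le_trans (ltW huv))// mulrCA ler_pM2l// ler_pM2l// -uv lerDr ltW//.
  apply/andP; split.
    rewrite -lerBrDl; apply: (aux _ (b i - x ord0 i)); rewrite ?subr_gt0//.
    by rewrite addrC addrA subrK.
  rewrite lerBrDl -lerBrDr; apply: (aux _ (x ord0 i - a i)); rewrite ?subr_gt0//.
    by rewrite addrA subrK.
  by rewrite (mulrC (b i - _)).
split; [exact: smooth_flat_prod|exact: cs|apply: (subset_trans sK) => x xK i].
have := xK i; rewrite /= !in_itv/= => /andP[h1 h2].
by rewrite (lt_le_trans _ h1) ?ltrDl// (le_lt_trans h2)// ltrBlDr ltrDl.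
Qed.

End bump.

Section fundamental_lemma.
Context {R : realType} {d : nat}.
Local Notation mu := (@lebesgue_rV R d).
Variable L : R.
Local Notation D := (@cube R d L).

(** Testing against bumps and letting n tend to infinity, with |h| as dominating function, gives a
    zero integral on every open box inside D. The pi-lambda theorem extends this to all measurable
    subsets of D, which forces h = 0 almost everywhere. *)
Lemma fundamental_lemma (h : 'rV[R]_d -> R) : mu.-integrable D (EFin \o h) ->
  (forall phi, test_function D phi -> \int[mu]_(x in D) (h x * phi x) = 0) ->
  {ae mu, forall x, D x -> h x = 0}.
Proof.
move=> hi h0; have mD : measurable D := measurable_cube L.
have mh : measurable_fun D h by exact: integrable_measurable hi.
have hbox a b : open_box a b `<=` D -> \int[mu]_(x in open_box a b) h x = 0.
  move=> abD; have [ab|/existsNP[i /negP]] := pselect (forall i, a i < b i); last first.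
    rewrite -leNgt => ba; rewrite (_ : open_box a b = set0) ?Rintegral_set0//.
    apply/seteqP; split => // x /(_ i) /=; rewrite in_itv/= => /andP[ax xb].
    by have := lt_trans ax xb; rewrite ltNge ba.
  have Dab : D `&` open_box a b = open_box a b by exact: setIidr.
  rewrite -Dab Rintegral_mkcondr.
  have cv : \int[mu]_(x in D) (h x * bump a b n x) @[n --> \oo] -->
      \int[mu]_(x in D) (h \_ (open_box a b)) x.
    refine (@Rintegral_dominated_cvg _ _ _ mu D mD (fun n x => h x * bump a b n x)
      (h \_ (open_box a b)) (fun x => `|h x|) _ _ _ _ _).
    - move=> n; apply: measurable_funM => //; apply: measurable_funTS.
      by apply: continuous_measurable_mx; exact: continuous_flat_prod.
    - by apply/(measurable_restrict _ (measurable_open_box a b) mD); rewrite Dab;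
        exact: (measurable_funS mD abD mh).
    - move=> x Dx; have -> : (h \_ (open_box a b)) x = h x * \1_(open_box a b) x.
        by rewrite patchE indicE; case: ifP; rewrite ?mulr1 ?mulr0.
      by apply: cvgM; [exact: cvg_cst|exact: bump_cvg].
    - exact: integrable_norm.
    - by move=> n x Dx; rewrite normrM ler_piMr// ger0_norm ?bump_ge0 ?bump_le1.
  have E : (fun n => \int[mu]_(x in D) (h x * bump a b n x)) = cst 0.
    apply/funext => n; apply: h0; apply: test_functionS abD _.
    exact: test_function_bump.
  by move: cv; rewrite E => /cvg_lim <-//; rewrite lim_cst.
(* Sets are intersected with D so that the class lives on the whole space. Closure under complements
   needs a zero integral over D, which holds because D is itself an open box. *)
pose H := [set A : set 'rV[R]_d | measurable A /\ (\int[mu]_(x in D `&` A) (h x)%:E = 0)%E].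
have hD : (\int[mu]_(x in D) (h x)%:E = 0)%E.
  have := @hbox (fun=> - (L / 2)) (fun=> L / 2); rewrite -cubeE => /(_ (@subset_refl _ _)).
  move=> h00; rewrite -[LHS]fineK ?(integrable_fin_num _ hi)//.
  by congr EFin.
have hiA A : measurable A -> mu.-integrable (D `&` A) (EFin \o h).
  move=> mA; apply: integrableS hi => //; exact: measurableI.
have dH : dynkin H.
  split.
  - by split => //; rewrite setIT.
  - move=> A [mA A0]; split; first exact: measurableC.
    have := @integral_setU_EFin _ _ _ mu (D `&` A) (D `&` ~` A) h.
    rewrite -setIUr setUv setIT A0 add0e hD => <-//.
    + exact: measurableI.
    + by apply: measurableI => //; exact: measurableC.
    + rewrite disj_set2E; apply/eqP; rewrite setIACA setICr setI0//.
  - move=> F tF HF; have mF k : measurable (F k) by have [] := HF k.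
    split; first exact: bigcupT_measurable.
    rewrite setI_bigcupr integral_bigcup.
    + by apply: eseries0 => k _ _; have [] := HF k.
    + by apply: trivIset_setIl.
    + by move=> k; exact: measurableI.
    + rewrite -setI_bigcupr; apply: hiA; exact: bigcupT_measurable.
have GH : @open_boxes R d `<=` H.
  move=> _ [a [b ->]]; split; first exact: measurable_open_box.
  have [a' [b' E]] : open_boxes (D `&` open_box a b).
    apply: open_boxes_setI; last by exists a, b.
    by rewrite cubeE; eexists; eexists; reflexivity.
  rewrite -[LHS]fineK ?(integrable_fin_num _ (hiA _ (measurable_open_box a b)))//; last first.
    by apply: measurableI => //; exact: measurable_open_box.
  by congr EFin; rewrite E; apply: hbox; rewrite -E; exact: subIsetl.
have HA A : measurable A -> H A.
  rewrite measurable_rVE; move: A; apply: lambda_system_subset => //.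
  - exact: open_boxes_setI.
  - exact/dynkin_lambda_system.
have := @integral_ae_eq _ _ _ mu D mD (cst 0%E) (EFin \o h) hi (measurable_cst _).
have aux E : E `<=` D -> measurable E ->
    (\int[mu]_(x in E) (EFin \o h) x)%E = (\int[mu]_(x in E) cst 0%E x)%E.
  move=> ED mE; rewrite integral0; have [_] := HA E mE.
  by rewrite setIidr.
by move=> /(_ aux); apply: filterS => x h1 /h1 [].
Qed.

End fundamental_lemma.

(** * Convergence in Lp on cubes *)

Section euclidean_norm.
Context {R : realType} {m n : nat}.
Implicit Types A B : 'M[R]_(m, n).

Lemma eucl_norm_ge0 A : 0 <= eucl_norm A.
Proof. exact: sqrtr_ge0. Qed.

Lemma eucl_norm_sqr A : eucl_norm A ^+ 2 = \sum_i \sum_j A i j ^+ 2.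
Proof.
by rewrite sqr_sqrtr//; apply: sumr_ge0 => i _; apply: sumr_ge0 => j _; exact: sqr_ge0.
Qed.

Lemma entry_le_eucl_norm A i j : `|A i j| <= eucl_norm A.
Proof.
rewrite -(ler_pXn2r (_ : 0 < 2)%N) ?nnegrE ?eucl_norm_ge0//
  eucl_norm_sqr real_normK ?num_real//.
rewrite (bigD1 i)//= (bigD1 j)//= -addrA lerDl addr_ge0// sumr_ge0// => k _.
  exact: sqr_ge0.
by apply: sumr_ge0 => l _; exact: sqr_ge0.
Qed.

Lemma eucl_norm0 : eucl_norm (0 : 'M[R]_(m, n)) = 0.
Proof.
by rewrite /eucl_norm big1 ?sqrtr0// => i _; rewrite big1// => j _; rewrite mxE expr0n.
Qed.

Lemma eucl_normZ (t : R) A : eucl_norm (t *: A) = `|t| * eucl_norm A.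
Proof.
rewrite /eucl_norm -sqrtr_sqr -sqrtrM ?sqr_ge0//; congr Num.sqrt.
rewrite mulr_sumr; apply: eq_bigr => i _; rewrite mulr_sumr; apply: eq_bigr => j _.
by rewrite mxE exprMn.
Qed.

(** A crude substitute for the triangle inequality, from (x + y)^2 <= 2 x^2 + 2 y^2 entry by entry.
    The maximum is what makes raising to the power p immediate in [eucl_normD_exp_le]. *)
Lemma eucl_normD_le A B : eucl_norm (A + B) <= 2 * Num.max (eucl_norm A) (eucl_norm B).
Proof.
have m0 : 0 <= Num.max (eucl_norm A) (eucl_norm B) by rewrite le_max eucl_norm_ge0.
rewrite -(ler_pXn2r (_ : 0 < 2)%N) ?nnegrE ?eucl_norm_ge0 ?mulr_ge0//.
have h : eucl_norm (A + B) ^+ 2 <= 2 * (eucl_norm A ^+ 2) + 2 * (eucl_norm B ^+ 2).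
  rewrite !eucl_norm_sqr !mulr_sumr -big_split/=; apply: ler_sum => i _.
  rewrite !mulr_sumr -big_split/=; apply: ler_sum => j _.
  rewrite mxE; have := sqr_ge0 (A i j - B i j); nra.
apply: (le_trans h); rewrite exprMn.
have hA : eucl_norm A ^+ 2 <= Num.max (eucl_norm A) (eucl_norm B) ^+ 2.
  by rewrite lerXn2r ?nnegrE ?eucl_norm_ge0// le_max lexx.
have hB : eucl_norm B ^+ 2 <= Num.max (eucl_norm A) (eucl_norm B) ^+ 2.
  by rewrite lerXn2r ?nnegrE ?eucl_norm_ge0// le_max lexx orbT.
lra.
Qed.

Lemma eucl_normD_exp_le p A B :
  eucl_norm (A + B) ^+ p <= 2 ^+ p * (eucl_norm A ^+ p + eucl_norm B ^+ p).
Proof.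
have m0 : 0 <= Num.max (eucl_norm A) (eucl_norm B) by rewrite le_max eucl_norm_ge0.
apply: (@le_trans _ _ ((2 * Num.max (eucl_norm A) (eucl_norm B)) ^+ p)).
  by rewrite lerXn2r ?nnegrE ?mulr_ge0 ?eucl_norm_ge0 ?eucl_normD_le.
rewrite exprMn ler_pM2l ?exprn_gt0//.
case: (leP (eucl_norm A)) => _; first by rewrite lerDr exprn_ge0 ?eucl_norm_ge0.
by rewrite lerDl exprn_ge0 ?eucl_norm_ge0.
Qed.

Lemma measurable_eucl_norm d (T : measurableType d) (D : set T) (f : T -> 'M[R]_(m, n)) :
  measurable_fun D f -> measurable_fun D (fun x => eucl_norm (f x)).
Proof.
move=> mf; apply: (@measurable_comp _ _ _ _ _ _ setT (@eucl_norm R m n)) => //.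
have ms : measurable_fun setT (@Num.sqrt R).
  by apply: continuous_measurable_fun; exact: sqrt_continuous.
apply: (measurableT_comp ms); apply: measurable_sum => i; apply: measurable_sum => j.
by apply: measurable_funX; exact: measurable_mx_entry.
Qed.

End euclidean_norm.

Section Lp_on_cube.
Context {R : realType} {d : nat}.
Local Notation mu := (@lebesgue_rV R d).
Implicit Types D : set 'rV[R]_d.

Lemma measurable_mx_entry_comp dT (T : measurableType dT) (A : set T) m n
    (f : T -> 'M[R]_(m, n)) i j :
  measurable_fun A f -> measurable_fun A (fun x => f x i j).
Proof. exact: (measurableT_comp (measurable_mx_entry i j)). Qed.

(** Either t <= e, or (t / e)^p >= 1 and t is absorbed by the second term. On sets of finite measure
    this replaces the Hölder inequality when passing from L^(p+1) to L^1. *)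
Lemma le_eps_exp p (t e : R) : 0 <= t -> 0 < e -> t <= e + e ^- p * t ^+ p.+1.
Proof.
move=> t0 e0; have [te|et] := leP t e.
  by rewrite (le_trans te)// lerDl mulr_ge0// ?exprn_ge0// invr_ge0 exprn_ge0// ltW.
rewrite exprSr mulrA -[leLHS]add0r lerD//; first exact: ltW.
rewrite -[leLHS]mul1r ler_wpM2r//.
by rewrite mulrC -expr_div_n exprn_ege1// ler_pdivlMr// mul1r ltW.
Qed.

Lemma cvg_integral_of_exp p D (N_ : nat -> 'rV[R]_d -> R) : measurable D ->
  (mu D < +oo)%E -> (forall k, measurable_fun D (N_ k)) -> (forall k x, 0 <= N_ k x) ->
  (\int[mu]_(x in D) (N_ k x ^+ p.+1)%:E)%E @[k --> \oo] --> (0 : \bar R) ->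
  (\int[mu]_(x in D) (N_ k x)%:E)%E @[k --> \oo] --> (0 : \bar R).
Proof.
move=> mD muD mN N0 Np.
have mN' q k : measurable_fun D (fun x => (N_ k x ^+ q)%:E).
  by apply/measurable_EFinP; exact: measurable_funX.
have bd k e : 0 < e -> (\int[mu]_(x in D) (N_ k x)%:E <=
    e%:E * mu D + (e ^- p)%:E * \int[mu]_(x in D) (N_ k x ^+ p.+1)%:E)%E.
  move=> e0; rewrite -integral_cst// -ge0_integralZl//; last 2 first.
  - by move=> x _; rewrite lee_fin exprn_ge0.
  - by rewrite lee_fin invr_ge0 exprn_ge0// ltW.
  rewrite -ge0_integralD//; last 3 first.
  - by move=> x _; rewrite lee_fin ltW.
  - by move=> x _; rewrite mule_ge0// lee_fin ?exprn_ge0// invr_ge0 exprn_ge0// ltW.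
  - by apply: measurable_funeM; exact: (mN' p.+1).
  apply: ge0_le_integral => //.
  - by move=> x _; rewrite lee_fin.
  - exact: (mN' 1).
  - by apply: emeasurable_funD => //; apply: measurable_funeM; exact: (mN' p.+1).
  - by move=> x _; rewrite -EFinM -EFinD lee_fin le_eps_exp.
pose mD' : R := fine (mu D).
have mDE : mu D = mD'%:E by rewrite fineK// ge0_fin_numE.
have mD0 : 0 <= mD' by exact: fine_ge0.
apply/fine_cvgP; split.
  have /fine_cvgP[+ _] := Np; apply: filterS => k fk.
  rewrite ge0_fin_numE; last by apply: integral_ge0 => x _; rewrite lee_fin.
  apply: (le_lt_trans (bd k 1 ltr01)); rewrite mDE -(fineK fk) -!EFinM -EFinD ltry//.
apply/cvgrPdist_le => /= e e0.
(* With this threshold the term e1 |D| is at most e / 2; the tolerance (e / 2) e1^p on the integral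
   of the power p + 1 then cancels the factor e1^(-p). Adding 1 to the measure avoids division by
   zero. *)
pose e1 := e / 2 / (mD' + 1).
have e10 : 0 < e1 by rewrite !divr_gt0// ltr_wpDl.
have /fine_cvgP[Nfin /cvgrPdist_le] := Np.
have e20 : 0 < e / 2 * e1 ^+ p by rewrite mulr_gt0 ?divr_gt0 ?exprn_gt0.
move=> /(_ _ e20) Nle.
near=> k.
have fk : (\int[mu]_(x in D) (N_ k x ^+ p.+1)%:E)%E \is a fin_num by near: k.
have lk : `|0 - fine (\int[mu]_(x in D) (N_ k x ^+ p.+1)%:E)%E| <= e / 2 * e1 ^+ p by near: k.
rewrite sub0r normrN ger0_norm; last first.
  by apply: fine_ge0; apply: integral_ge0 => x _; rewrite lee_fin.
rewrite -lee_fin fineK; last first.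
  rewrite ge0_fin_numE; last by apply: integral_ge0 => x _; rewrite lee_fin.
  apply: (le_lt_trans (bd k 1 ltr01)); rewrite mDE -(fineK fk) -!EFinM -EFinD ltry//.
apply: (le_trans (bd k e1 e10)).
rewrite mDE -(fineK fk) -!EFinM -EFinD lee_fin [leRHS]splitr lerD//.
  rewrite /e1 mulrAC ler_pdivrMr ?ltr_wpDl// ler_wpM2l ?lerDl//.
  by rewrite divr_ge0// ltW.
rewrite mulrC ler_pdivrMr ?exprn_gt0//; move: lk.
rewrite sub0r normrN ger0_norm//.
by apply: fine_ge0; apply: integral_ge0 => x _; rewrite lee_fin exprn_ge0.
Unshelve. all: by end_near. Qed.

Lemma inLp_integrable p L m n (f : 'rV[R]_d -> 'M[R]_(m, n)) i j :
  inLp p.+1 (cube L) f -> mu.-integrable (cube L) (EFin \o (fun x => f x i j)).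
Proof.
move=> [mf fp]; have mD := @measurable_cube R d L.
have mfij := @measurable_mx_entry_comp _ _ (cube L) _ _ f i j mf.
apply/integrableP; split; first exact/measurable_EFinP.
apply: (@le_lt_trans _ _ (\int[mu]_(x in cube L) (1 + (eucl_norm (f x) ^+ p.+1)%:E))%E).
  apply: ge0_le_integral => //.
  - by apply/measurable_EFinP; exact: measurableT_comp.
  - apply: emeasurable_funD => //; apply/measurable_EFinP; apply: measurable_funX.
    exact: measurable_eucl_norm.
  - move=> x _; rewrite -EFinD lee_fin.
    rewrite (le_trans (entry_le_eucl_norm _ _ _))//.
    have := @le_eps_exp p _ 1 (eucl_norm_ge0 (f x)) ltr01.
    by rewrite expr1n invr1 mul1r.
rewrite ge0_integralD//.
- rewrite integral_cst//= mul1e lte_add_pinfty//; exact: lebesgue_cube_lty.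
- by move=> x _; rewrite lee_fin exprn_ge0// eucl_norm_ge0.
- by apply/measurable_EFinP; apply: measurable_funX; exact: measurable_eucl_norm.
Qed.

(** Strong convergence, through L^1, passes to the limit against a bounded factor; this is what
    carries integration by parts from the approximants to their limit. *)
Lemma cvg_Rintegral_Lp p L m n (f_ : nat -> 'rV[R]_d -> 'M[R]_(m, n))
    f (psi : 'rV[R]_d -> R) (M : R) i j :
  (forall k, measurable_fun (cube L) (f_ k)) ->
  (forall k, mu.-integrable (cube L) (EFin \o (fun x => f_ k x i j))) ->
  inLp p.+1 (cube L) f ->
  cvgLp p.+1 (cube L) f_ f ->
  measurable_fun (cube L) psi -> (forall x, cube L x -> `|psi x| <= M) ->
  \int[mu]_(x in cube L) (f_ k x i j * psi x) @[k --> \oo] -->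
    \int[mu]_(x in cube L) (f x i j * psi x).
Proof.
move=> mf_ f_i fp f_f mpsi psiM; have mD := @measurable_cube R d L.
have fi := inLp_integrable i j fp; have [mf _] := fp.
have mN k : measurable_fun (cube L) (fun x => eucl_norm (f_ k x - f x)).
  apply: measurable_eucl_norm; apply: measurable_fun_mx => i' j'.
  under eq_fun do rewrite mxE [X in _ + X]mxE.
  by apply: measurable_funB; exact: measurable_mx_entry_comp.
have N0 k x : 0 <= eucl_norm (f_ k x - f x) by exact: eucl_norm_ge0.
have /fine_cvgP[Nfin Ncvg] := @cvg_integral_of_exp p _ _ mD (lebesgue_cube_lty L) mN N0 f_f.
have bpsi : [bounded psi x | x in (cube L : set 'rV[R]_d)].
  exists M; split; first exact: num_real.
  by move=> y My x Dx /=; rewrite (le_trans (psiM _ Dx))// ltW.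
have mulpsi h : mu.-integrable (cube L) (EFin \o h) ->
    mu.-integrable (cube L) (EFin \o (fun x => h x * psi x)).
  by move=> hi; have := integrableMl mD hi mpsi bpsi.
apply/cvgrPdist_le => e e0.
move: Ncvg => /cvgrPdist_le.
have M1 : 0 < `|M| + 1 by rewrite ltr_wpDl.
move=> /(_ (e / (`|M| + 1))); rewrite divr_gt0// => /(_ isT) Nle.
near=> k.
have fk : (\int[mu]_(x in cube L) (eucl_norm (f_ k x - f x))%:E)%E \is a fin_num by near: k.
have lk : `|0 - fine (\int[mu]_(x in cube L) (eucl_norm (f_ k x - f x))%:E)%E|
    <= e / (`|M| + 1).
  by near: k.
have Ni : mu.-integrable (cube L) (EFin \o (fun x => eucl_norm (f_ k x - f x))).
  apply/integrableP; split; first exact/measurable_EFinP.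
  under eq_integral do rewrite /= ger0_norm//.
  by rewrite -ge0_fin_numE// integral_ge0// => x _; rewrite lee_fin.
rewrite -RintegralB//; [|exact: mulpsi|exact: mulpsi].
apply: (le_trans (le_normr_Rintegral mD _)).
  by apply: integrableB_EFin => //; exact: mulpsi.
apply: (@le_trans _ _ (\int[mu]_(x in cube L) ((`|M| + 1) * eucl_norm (f_ k x - f x)))).
  apply: le_Rintegral => //.
  - by apply: integrable_norm; apply: integrableB_EFin => //; exact: mulpsi.
  - exact: integrableZ_EFin.
  - move=> x Dx; rewrite -mulrBl normrM mulrC ler_pM//.
      by rewrite (le_trans (psiM _ Dx))// (le_trans (ler_norm _))// lerDl.
    have := entry_le_eucl_norm (f_ k x - f x) i j.
    by rewrite !mxE distrC.
rewrite RintegralZl// mulrC -ler_pdivlMr//.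
move: lk; rewrite sub0r normrN ger0_norm//.
by apply: fine_ge0; apply: integral_ge0 => x _; rewrite lee_fin.
Unshelve. all: by end_near. Qed.

End Lp_on_cube.

(** * Pairs (u, gradient of u) approximated by test functions *)

Section integral_cube.
Context {R : realType} {d : nat}.
Local Notation mu := (@lebesgue_rV R d).

Lemma integral_subset_supp (D D' : set 'rV[R]_d) (F : 'rV[R]_d -> \bar R) :
  D `<=` D' -> (forall x, D' x -> ~ D x -> F x = 0%E) ->
  (\int[mu]_(x in D') F x = \int[mu]_(x in D) F x)%E.
Proof.
move=> DD' F0; rewrite integral_mkcond [RHS]integral_mkcond; congr (integral _ _ _).
apply/funext => x; rewrite !patchE; have [xD|/negP] := boolP (x \in D).
  by rewrite mem_set//; apply: DD'; exact: set_mem.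
rewrite inE => nD; case: ifPn => //; rewrite inE => D'x; exact: F0.
Qed.

Lemma preimage_dilate_cube (L r : R) : 0 < r ->
  (fun x : 'rV[R]_d => r *: x + 0) @^-1` cube L = cube (L / r).
Proof.
move=> r0; apply/seteqP; split => x /=; rewrite addr0.
  exact: (scale_cube L x r0).1.
exact: (scale_cube L x r0).2.
Qed.

Lemma ge0_integral_dilate_cube (L r : R) (F : 'rV[R]_d -> \bar R) : 0 < r ->
  measurable_fun (cube L) F -> (forall x, 0 <= F x)%E ->
  (\int[mu]_(x in cube (L / r)) F (r *: x)%R =
   (r^-1 ^+ d)%:E * \int[mu]_(x in cube L) F x)%E.
Proof.
move=> r0 mF F0.
have := @ge0_integral_affine_rV R d r 0 _ F r0 (measurable_cube L) mF (fun x _ => F0 x).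
rewrite preimage_dilate_cube// => <-.
by apply: eq_integral => x _; rewrite addr0.
Qed.

Lemma measurable_dilate_cube dS (S : measurableType dS) (L r : R) (F : 'rV[R]_d -> S) :
  0 < r -> measurable_fun (cube L) F ->
  measurable_fun (cube (L / r)) (fun x : 'rV[R]_d => F (r *: x)).
Proof.
move=> r0 mF; rewrite -preimage_dilate_cube//.
have -> : (fun x : 'rV[R]_d => F (r *: x)) = F \o (fun x : 'rV[R]_d => r *: x + 0).
  by apply/funext => x /=; rewrite addr0.
apply: (@measurable_comp _ _ _ _ _ _ (cube L)) => //.
- exact: measurable_cube.
- by move=> _ [x /= h <-].
- apply: measurable_funTS; exact: measurable_affine_rV.
Qed.

End integral_cube.

Lemma cvge0Z (R : realType) (a : nat -> \bar R) (c : R) :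
  a k @[k --> \oo] --> 0%E -> (c%:E * a k)%E @[k --> \oo] --> 0%E.
Proof. by move=> a0; rewrite -[X in _ --> X](mule0 c%:E); exact: cvgeZl. Qed.

Lemma cvge0_lin (R : realType) (a b : nat -> \bar R) (c : R) :
  a k @[k --> \oo] --> 0%E -> b k @[k --> \oo] --> 0%E ->
  (c%:E * (a k + b k))%E @[k --> \oo] --> 0%E.
Proof.
move=> a0 b0; apply: cvge0Z.
by rewrite -[X in _ --> X](add0e 0%E); apply: cvgeD.
Qed.

(** * Sums, dilations and zero extensions in Lp *)

Section Lp_operations.
Context {R : realType} {d m n : nat}.
Local Notation mu := (@lebesgue_rV R d).
Implicit Types (f g : 'rV[R]_d -> 'M[R]_(m, n)) (D : set 'rV[R]_d) (p : nat).

Lemma measurable_fun_mxD D f g : measurable_fun D f -> measurable_fun D g ->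
  measurable_fun D (fun x => f x + g x).
Proof.
move=> mf mg; apply: measurable_fun_mx => i j; under eq_fun do rewrite mxE.
by apply: measurable_funD; exact: measurable_mx_entry_comp.
Qed.

Lemma measurable_fun_mxZ D (c : R) f : measurable_fun D f ->
  measurable_fun D (fun x => c *: f x).
Proof.
move=> mf; apply: measurable_fun_mx => i j; under eq_fun do rewrite mxE.
by apply: measurable_funM => //; exact: measurable_mx_entry_comp.
Qed.

Lemma measurable_fun_mxB D f g : measurable_fun D f -> measurable_fun D g ->
  measurable_fun D (fun x => f x - g x).
Proof.
move=> mf /(measurable_fun_mxZ (-1)) mg; have := measurable_fun_mxD mf mg.
by under eq_fun do rewrite scaleN1r.
Qed.

Lemma measurable_fun_mx_restrict D D' f : measurable D -> measurable D' -> D `<=` D' ->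
  measurable_fun D f -> measurable_fun D' (patch (fun=> 0) D f).
Proof.
move=> mD mD' DD' mf; apply: measurable_fun_mx => i j.
have -> : (fun x => (patch (fun=> 0) D f) x i j) = (fun x => f x i j) \_ D.
  by apply/funext => x; rewrite /patch; case: ifP; rewrite ?mxE.
apply/(measurable_restrict _ mD mD'); rewrite (setIidr DD').
exact: measurable_mx_entry_comp.
Qed.

Lemma measurable_eucl_norm_exp p D f : measurable_fun D f ->
  measurable_fun D (fun x => (eucl_norm (f x) ^+ p)%:E).
Proof.
by move=> mf; apply/measurable_EFinP; apply: measurable_funX; exact: measurable_eucl_norm.
Qed.

Lemma eucl_norm_exp_ge0 p f x : (0 <= (eucl_norm (f x) ^+ p)%:E)%E.
Proof. by rewrite lee_fin exprn_ge0// eucl_norm_ge0. Qed.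

Lemma integral_eucl_normD_le p D f g : measurable D ->
  measurable_fun D f -> measurable_fun D g ->
  (\int[mu]_(x in D) (eucl_norm (f x + g x)%R ^+ p)%:E <=
   (2 ^+ p)%:E * (\int[mu]_(x in D) (eucl_norm (f x) ^+ p)%:E +
                  \int[mu]_(x in D) (eucl_norm (g x) ^+ p)%:E))%E.
Proof.
move=> mD mf mg; have mfp := measurable_eucl_norm_exp p mf.
have mgp := measurable_eucl_norm_exp p mg.
rewrite -ge0_integralD//; [|by move=> x _; exact: eucl_norm_exp_ge0..].
rewrite -ge0_integralZl//; first last.
- by move=> x _; rewrite adde_ge0// eucl_norm_exp_ge0.
- exact: emeasurable_funD.
apply: ge0_le_integral => //.
- by move=> x _; rewrite lee_fin exprn_ge0// eucl_norm_ge0.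
- by apply: measurable_eucl_norm_exp; exact: measurable_fun_mxD.
- by apply: measurable_funeM; exact: emeasurable_funD.
- by move=> x _; rewrite -EFinD -EFinM lee_fin eucl_normD_exp_le.
Qed.

Lemma inLpD p D f g : measurable D -> inLp p D f -> inLp p D g ->
  inLp p D (fun x => f x + g x).
Proof.
move=> mD [mf fp] [mg gp]; split; first exact: measurable_fun_mxD.
apply: (le_lt_trans (integral_eucl_normD_le p mD mf mg)).
by rewrite lte_mul_pinfty ?lee_fin ?exprn_ge0//; exact: lte_add_pinfty.
Qed.

Lemma inLp_cst p L (M : 'M[R]_(m, n)) : inLp p (@cube R d L) (fun=> M).
Proof.
split; first exact: measurable_cst.
rewrite integral_cst; last exact: measurable_cube.
rewrite lte_mul_pinfty ?lee_fin ?exprn_ge0 ?eucl_norm_ge0//.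
exact: lebesgue_cube_lty.
Qed.

Lemma inLp_dilate p L (c r : R) f : 0 < r -> inLp p (cube L) f ->
  inLp p (cube (L / r)) (fun x => c *: f (r *: x)).
Proof.
move=> r0 [mf fp]; split.
  by apply: measurable_fun_mxZ; exact: measurable_dilate_cube.
have := @ge0_integral_dilate_cube _ _ L r (fun x => (eucl_norm (c *: f x) ^+ p)%:E) r0.
move=> -> ; first last.
- exact: (eucl_norm_exp_ge0 p (fun x => c *: f x)).
- exact: (measurable_eucl_norm_exp p (measurable_fun_mxZ c mf)).
rewrite lte_mul_pinfty ?lee_fin ?exprn_ge0 ?invr_ge0 ?(ltW r0)//.
under eq_integral do rewrite eucl_normZ exprMn EFinM.
rewrite ge0_integralZl//.
- by rewrite lte_mul_pinfty// lee_fin exprn_ge0.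
- exact: measurable_cube.
- exact: measurable_eucl_norm_exp.
- by move=> x _; exact: eucl_norm_exp_ge0.
Qed.

Lemma inLp_restrict p L L' f : (0 < p)%N -> L <= L' -> inLp p (cube L) f ->
  inLp p (cube L') (patch (fun=> 0) (cube L) f).
Proof.
move=> p0 LL' [mf fp]; have sL := @sub_cube R d _ _ LL'; split.
  by apply: measurable_fun_mx_restrict => //; exact: measurable_cube.
rewrite (integral_subset_supp sL) => [|x _ nx]; last first.
  by rewrite /patch memNset// eucl_norm0 expr0n gtn_eqF.
rewrite (eq_integral (fun x => (eucl_norm (f x) ^+ p)%:E))// => x xL.
by rewrite /patch xL.
Qed.

Lemma cvgLpD p D (f_ g_ : nat -> 'rV[R]_d -> 'M[R]_(m, n)) f g : measurable D ->
  (forall k, measurable_fun D (f_ k)) -> (forall k, measurable_fun D (g_ k)) ->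
  measurable_fun D f -> measurable_fun D g ->
  cvgLp p D f_ f -> cvgLp p D g_ g ->
  cvgLp p D (fun k x => f_ k x + g_ k x) (fun x => f x + g x).
Proof.
move=> mD mf_ mg_ mf mg cf cg.
pose B k : \bar R := ((2 ^+ p)%:E *
  (\int[mu]_(x in D) (eucl_norm (f_ k x - f x)%R ^+ p)%:E +
   \int[mu]_(x in D) (eucl_norm (g_ k x - g x)%R ^+ p)%:E))%E.
have B0 : B k @[k --> \oo] --> 0%E by exact: cvge0_lin cf cg.
rewrite /cvgLp; refine (@squeeze_cvge _ _ _ _ (cst 0%E) _ B _ _ (cvg_cst _) B0).
near=> k; apply/andP; split.
  by apply: integral_ge0 => x _; rewrite lee_fin exprn_ge0// eucl_norm_ge0.
under eq_integral do rewrite opprD addrACA.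
by apply: integral_eucl_normD_le => //; exact: measurable_fun_mxB.
Unshelve. all: by end_near. Qed.

Lemma cvgLp_dilate p L (c r : R) (f_ : nat -> 'rV[R]_d -> 'M[R]_(m, n)) f : 0 < r ->
  (forall k, measurable_fun (cube L) (f_ k)) -> measurable_fun (cube L) f ->
  cvgLp p (cube L) f_ f ->
  cvgLp p (cube (L / r)) (fun k x => c *: f_ k (r *: x)) (fun x => c *: f (r *: x)).
Proof.
move=> r0 mf_ mf cf; rewrite /cvgLp.
have E k : (\int[mu]_(x in cube (L / r))
    (eucl_norm (c *: f_ k (r *: x) - c *: f (r *: x))%R ^+ p)%:E =
  (r^-1 ^+ d * `|c| ^+ p)%:E * \int[mu]_(x in cube L) (eucl_norm (f_ k x - f x)%R ^+ p)%:E)%E.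
  have mB := measurable_fun_mxB (mf_ k) mf.
  have := @ge0_integral_dilate_cube _ _ L r
    (fun x => (eucl_norm (c *: f_ k x - c *: f x) ^+ p)%:E) r0.
  move=> ->; first last.
  - by move=> x; rewrite lee_fin exprn_ge0// eucl_norm_ge0.
  - apply: measurable_eucl_norm_exp; under eq_fun do rewrite -scalerBr.
    exact: measurable_fun_mxZ.
  rewrite EFinM -muleA; congr (_ * _)%E.
  under eq_integral do rewrite -scalerBr eucl_normZ exprMn EFinM.
  rewrite ge0_integralZl//.
  - exact: measurable_cube.
  - exact: measurable_eucl_norm_exp.
  - by move=> x _; rewrite lee_fin exprn_ge0// eucl_norm_ge0.
under eq_fun do rewrite E.
exact: cvge0Z.
Qed.

(** Outside the small cube the approximants and the extension are both zero, so no error is added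
    there; p > 0 ensures that the zero norm contributes [0 ^+ p = 0]. *)
Lemma cvgLp_restrict p L L' (f_ : nat -> 'rV[R]_d -> 'M[R]_(m, n)) f : (0 < p)%N -> L <= L' ->
  (forall k x, ~ cube L x -> f_ k x = 0) -> cvgLp p (cube L) f_ f ->
  cvgLp p (cube L') f_ (patch (fun=> 0) (cube L) f).
Proof.
move=> p0 LL' f0 cf; have sL := @sub_cube R d _ _ LL'.
have E k : (\int[mu]_(x in cube L')
      (eucl_norm (f_ k x - patch (fun=> 0) (cube L) f x)%R ^+ p)%:E =
    \int[mu]_(x in cube L) (eucl_norm (f_ k x - f x)%R ^+ p)%:E)%E.
  rewrite (integral_subset_supp sL) => [|x _ nx]; last first.
    by rewrite /patch memNset// f0// subr0 eucl_norm0 expr0n gtn_eqF.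
  by apply: eq_integral => x xL; rewrite /patch xL.
by rewrite /cvgLp; under eq_fun do rewrite E.
Qed.

End Lp_operations.

Section W1p0_pairs.
Context {R : realType} {d m : nat}.
Local Notation mu := (@lebesgue_rV R d).
Implicit Types (u : 'rV[R]_d -> 'rV[R]_m) (G : 'rV[R]_d -> 'M[R]_(m, d)).
Implicit Types (D : set 'rV[R]_d) (p : nat) (L r c : R).

(* [W1p0] without the weak gradient identity, which then holds automatically
   because it passes to the limit from test functions. *)
Definition W1p0_pair p D u G : Prop :=
  [/\ inLp p D u, inLp p D G &
    exists phi_ : nat -> 'rV[R]_d -> 'rV[R]_m,
      [/\ forall k i, test_function D (component (phi_ k) i),
          cvgLp p D phi_ u & cvgLp p D (fun k => grad (phi_ k)) G]].

Lemma measurable_test (phi : 'rV[R]_d -> 'rV[R]_m) D D' :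
  (forall i, test_function D (component phi i)) -> measurable_fun D' phi.
Proof.
move=> tphi; apply: measurable_fun_mx => i j; rewrite (ord1 i).
apply: measurable_funTS; apply: (@continuous_measurable_mx _ _ _ (component phi j)).
by have [/smooth_continuous] := tphi j.
Qed.

Lemma measurable_grad_test (phi : 'rV[R]_d -> 'rV[R]_m) D D' :
  (forall i, test_function D (component phi i)) -> measurable_fun D' (grad phi).
Proof.
move=> tphi; apply: measurable_fun_mx => i j; under eq_fun do rewrite mxE.
apply: measurable_funTS; apply: continuous_measurable_mx.
by have [/smooth_continuous_partial] := tphi i.
Qed.

(** For each approximant this is integration by parts, and both sides converge. The constant [z]
    contributes z_i times the integral of a partial derivative of a test function, which is zero. *)
Lemma W1p0_pair_weak_gradient p L u G (z : 'rV[R]_m) i j phi :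
  W1p0_pair p.+1 (cube L) u G -> test_function (cube L) phi ->
  \int[mu]_(x in cube L) (component (fun x => u x + z) i x * partial j phi x) =
  - \int[mu]_(x in cube L) (G x i j * phi x).
Proof.
move=> [uL GL [phi_ [tphi_ uc Gc]]] tphi; have [sphi _ _] := tphi.
have mD := @measurable_cube R d L; have sD := @subset_refl _ (@cube R d L).
have cphi := smooth_continuous sphi; have cdphi := smooth_continuous_partial (j := j) sphi.
have [x|M _ phiM] := bounded_continuous_cube (r := L) cphi.
  exact: test_function_eq0 tphi.
have [x|N _ dphiN] := bounded_continuous_cube (r := L) cdphi.
  exact: test_function_partial0 tphi.
have mphi : measurable_fun (cube L) phi.
  by apply: measurable_funTS; exact: continuous_measurable_mx.
have mdphi : measurable_fun (cube L) (partial j phi).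
  by apply: measurable_funTS; exact: continuous_measurable_mx.
have dphii : mu.-integrable (cube L) (EFin \o partial j phi).
  exact: (integrable_bounded mD sD).
have mul_i h : mu.-integrable (cube L) (EFin \o h) ->
    mu.-integrable (cube L) (EFin \o (fun x => h x * partial j phi x)).
  move=> hi; have := integrableMl mD hi mdphi; apply.
  exists N; split; first exact: num_real.
  by move=> y Ny x Dx /=; rewrite (le_trans (dphiN _))// ltW.
have -> : \int[mu]_(x in cube L) (component (fun x => u x + z) i x * partial j phi x) =
    \int[mu]_(x in cube L) (u x ord0 i * partial j phi x).
  under eq_Rintegral do rewrite /component mxE mulrDl.
  rewrite RintegralD//.
  - by rewrite RintegralZl// (Rintegral_test_partial0 _ sD tphi) mulr0 addr0.
  - by apply: mul_i; exact: inLp_integrable uL.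
  - exact: integrableZ_EFin.
have lhs := @cvg_Rintegral_Lp _ _ p L _ _ phi_ u (partial j phi) N ord0 i
  (fun k => measurable_test (tphi_ k))
  (fun k => test_function_integrable mD sD (tphi_ k i)) uL uc mdphi (fun x _ => dphiN x).
have gi k : mu.-integrable (cube L) (EFin \o (fun x => grad (phi_ k) x i j)).
  have [sk _ _] := tphi_ k i; have ck := smooth_continuous_partial (j := j) sk.
  have [x|K _ dK] := bounded_continuous_cube (r := L) ck.
    exact: test_function_partial0 (tphi_ k i).
  apply: (integrable_bounded (M := K) mD sD) => [|x _]; last by rewrite mxE.
  by apply: measurable_mx_entry_comp; exact: measurable_grad_test (tphi_ k).
have rhs := @cvg_Rintegral_Lp _ _ p L _ _ _ G phi M i j
  (fun k => measurable_grad_test (tphi_ k)) gi GL Gc mphi (fun x _ => phiM x).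
have E k : \int[mu]_(x in cube L) (phi_ k x ord0 i * partial j phi x) =
    - \int[mu]_(x in cube L) (grad (phi_ k) x i j * phi x).
  rewrite (Rintegral_test_by_parts j mD sD (tphi_ k i) tphi); congr (- _).
  by apply: eq_Rintegral => x _; rewrite mxE.
move: lhs; under eq_fun do rewrite E.
move=> /cvg_lim <-//; apply/cvg_lim => //; exact: cvgN.
Qed.

Lemma W1p0_pair_W1p p L u G (z : 'rV[R]_m) : W1p0_pair p.+1 (cube L) u G ->
  W1p p.+1 (cube L) (fun x => u x + z) G.
Proof.
move=> uG; have [uL GL _] := uG; split.
- exact: (inLpD (measurable_cube L) uL (inLp_cst _ _ z)).
- exact: GL.
- by move=> i j phi tphi; rewrite (W1p0_pair_weak_gradient z i j uG tphi).
Qed.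

Lemma W1p0_pair_W1p0 p L u G : W1p0_pair p.+1 (cube L) u G -> W1p0 p.+1 (cube L) u.
Proof.
move=> uG; exists G; have [_ _ ?] := uG; split => //.
have := W1p0_pair_W1p 0 uG.
by rewrite (_ : (fun x => u x + 0) = u)//; apply/funext => x; rewrite addr0.
Qed.

Lemma W1p0_pairD p D u G u' G' : measurable D -> W1p0_pair p D u G ->
  W1p0_pair p D u' G' -> W1p0_pair p D (fun x => u x + u' x) (fun x => G x + G' x).
Proof.
move=> mD [uL GL [phi_ [t1 c1 d1]]] [uL' GL' [psi_ [t2 c2 d2]]]; split.
- exact: inLpD.
- exact: inLpD.
have cE k i : component (fun x => phi_ k x + psi_ k x) i =
    (fun x => component (phi_ k) i x + component (psi_ k) i x).
  by apply/funext => x; rewrite /component mxE.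
exists (fun k x => phi_ k x + psi_ k x); split.
- by move=> k i; rewrite cE; exact: test_functionD.
- exact: (cvgLpD mD (fun k => measurable_test (t1 k)) (fun k => measurable_test (t2 k))
    uL.1 uL'.1 c1 c2).
- have -> : (fun k => grad (fun x => phi_ k x + psi_ k x)) =
      (fun k x => grad (phi_ k) x + grad (psi_ k) x).
    apply/funext => k; apply/funext => x; apply/matrixP => i j.
    rewrite !mxE cE /partial deriveD//; apply: smooth_derivable.
      by have [] := t1 k i.
    by have [] := t2 k i.
  exact: (cvgLpD mD (fun k => measurable_grad_test (t1 k))
    (fun k => measurable_grad_test (t2 k)) GL.1 GL'.1 d1 d2).
Qed.

Lemma W1p0_pair_dilate p L c r u G : 0 < r -> W1p0_pair p (cube L) u G ->
  W1p0_pair p (cube (L / r)) (fun x => c *: u (r *: x)) (fun x => (c * r) *: G (r *: x)).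
Proof.
move=> r0 [uL GL [phi_ [t1 c1 d1]]]; split.
- exact: inLp_dilate.
- exact: inLp_dilate.
have cE k i : component (fun x => c *: phi_ k (r *: x)) i =
    (fun x => c * component (phi_ k) i (r *: x)).
  by apply/funext => x; rewrite /component mxE.
exists (fun k x => c *: phi_ k (r *: x)); split.
- move=> k i; rewrite cE; apply: test_function_dilate (t1 k i); first exact: lt0r_neq0.
  by move=> x; exact: (scale_cube L x r0).1.
- exact: (cvgLp_dilate c r0 (fun k => measurable_test (t1 k)) uL.1 c1).
- have -> : (fun k => grad (fun x => c *: phi_ k (r *: x))) =
      (fun k x => (c * r) *: grad (phi_ k) (r *: x)).
    apply/funext => k; apply/funext => x; apply/matrixP => i j.
    rewrite !mxE cE; have [s1 _ _] := t1 k i.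
    by have [_] := is_derive_dilate c (smooth_derivable s1 (j := j) (x := r *: x)).
  exact: (cvgLp_dilate (c * r) r0 (fun k => measurable_grad_test (t1 k)) GL.1 d1).
Qed.

(** The same approximants serve on the larger cube, since test functions of Q(L) are test functions
    of Q(L'). Zero boundary values enter the gluing here. *)
Lemma W1p0_pair_restrict p L L' u G : (0 < p)%N -> L <= L' ->
  W1p0_pair p (cube L) u G ->
  W1p0_pair p (cube L') (patch (fun=> 0) (cube L) u) (patch (fun=> 0) (cube L) G).
Proof.
move=> p0 LL' [uL GL [phi_ [t1 c1 d1]]]; split.
- exact: inLp_restrict.
- exact: inLp_restrict.
exists phi_; split.
- by move=> k i; apply: test_functionS (t1 k i); exact: sub_cube.
- apply: (fun h => cvgLp_restrict p0 LL' h c1) => k x nx; apply/matrixP => i j.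
  by rewrite (ord1 i) mxE; exact: test_function_eq0 (t1 k j) nx.
- apply: (fun h => cvgLp_restrict p0 LL' h d1) => k x nx; apply/matrixP => i j.
  by rewrite !mxE; exact: test_function_partial0 (t1 k i) nx.
Qed.

End W1p0_pairs.

(** * Gluing *)

(** An infimum may be +oo, for instance over an empty set of competitors, and then the bound is
    trivial. Otherwise near-minimisers within e / (c1 + c2) give a total error of exactly [e]. *)
Lemma le_lin_ereal_inf (R : realType) (S1 S2 : set (\bar R)) (c1 c2 : R) (x : \bar R) :
  0 < c1 -> 0 < c2 -> (forall y, S1 y -> 0 <= y)%E -> (forall y, S2 y -> 0 <= y)%E ->
  (forall y1 y2, S1 y1 -> S2 y2 -> x <= c1%:E * y1 + c2%:E * y2)%E ->
  (x <= c1%:E * ereal_inf S1 + c2%:E * ereal_inf S2)%E.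
Proof.
move=> c10 c20 S10 S20 hx.
have i1 : (0 <= ereal_inf S1)%E by exact: le_ereal_inf_tmp.
have i2 : (0 <= ereal_inf S2)%E by exact: le_ereal_inf_tmp.
have nN (y : \bar R) : (0 <= y)%E -> y != -oo%E by case: y.
have [m1|m1] := eqVneq (ereal_inf S1) +oo%E.
  rewrite m1 gt0_muley ?lte_fin// addye ?leey// nN//.
  by rewrite mule_ge0// lee_fin ltW.
have [m2|m2] := eqVneq (ereal_inf S2) +oo%E.
  rewrite m2 gt0_muley ?lte_fin// addey ?leey// nN//.
  by rewrite mule_ge0// lee_fin ltW.
have f1 : ereal_inf S1 \is a fin_num by rewrite ge0_fin_numE// ltey.
have f2 : ereal_inf S2 \is a fin_num by rewrite ge0_fin_numE// ltey.
apply/lee_addgt0Pr => e e0.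
have K0 : 0 < c1 + c2 by rewrite addr_gt0.
have eK : 0 < e / (c1 + c2) by rewrite divr_gt0.
have [y1 Sy1 h1] := lb_ereal_inf_adherent eK f1.
have [y2 Sy2 h2] := lb_ereal_inf_adherent eK f2.
apply: (le_trans (hx _ _ Sy1 Sy2)).
apply: (@le_trans _ _ (c1%:E * (ereal_inf S1 + (e / (c1 + c2))%:E) +
    c2%:E * (ereal_inf S2 + (e / (c1 + c2))%:E))%E).
  by apply: leeD; rewrite lee_pmul2l ?lte_fin//; exact: ltW.
clear -f1 f2 K0; move: (ereal_inf S1) (ereal_inf S2) f1 f2.
move=> [r1| |]//[r2| |]// _ _.
suff : c1 * (r1 + e / (c1 + c2)) + c2 * (r2 + e / (c1 + c2)) <=
  c1 * r1 + c2 * r2 + e by [].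
by rewrite !mulrDr addrACA -mulrDl (mulrCA (c1 + c2)) mulfV ?mulr1// gt_eqF.
Qed.

Section gluing.
Context {R : realType} {m d : nat}.
Local Notation mu := (@lebesgue_rV R d.+1).
Local Notation rV := 'rV[R]_d.+1.
Implicit Types (v : rV -> 'rV[R]_m) (G : rV -> 'M[R]_(m, d.+1)) (L r : R).

Lemma ae_dilate r (P : rV -> Prop) : 0 < r ->
  {ae mu, forall x, P x} -> {ae mu, forall x, P (r *: x)}.
Proof.
move=> r0 [A [mA A0 PA]]; exists ((fun x : rV => r *: x + 0) @^-1` A); split.
- rewrite -[X in measurable X]setTI; exact: measurable_affine_rV.
- by rewrite lebesgue_rV_affine//; apply/eqP; rewrite mule_eq0; apply/orP; right; apply/eqP.
- by move=> x /= nP; rewrite addr0; apply: PA.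
Qed.

Lemma W1p0_pairZ p L (c : R) v G : W1p0_pair p (cube L) v G ->
  W1p0_pair p (cube L) (fun x => c *: v x) (fun x => c *: G x).
Proof.
move=> /(W1p0_pair_dilate c ltr01); rewrite divr1 mulr1.
have -> : (fun x => c *: v (1 *: x)) = (fun x => c *: v x).
  by apply/funext => x; rewrite scale1r.
have -> // : (fun x => c *: G (1 *: x)) = (fun x => c *: G x).
by apply/funext => x; rewrite scale1r.
Qed.

Lemma integrable_mul_continuous L (h phi : rV -> R) : continuous phi ->
  (forall x, ~ cube L x -> phi x = 0) -> mu.-integrable (cube L) (EFin \o h) ->
  mu.-integrable (cube L) (EFin \o (fun x => h x * phi x)).
Proof.
move=> cphi phi0 hi; have [M _ phiM] := bounded_continuous_cube cphi phi0.
have mphi : measurable_fun (cube L) phi.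
  by apply: measurable_funTS; exact: continuous_measurable_mx.
have := integrableMl (measurable_cube L) hi mphi; apply.
exists M; split; first exact: num_real.
by move=> y My x Dx /=; rewrite (le_trans (phiM _))// ltW.
Qed.

Lemma ae_eq_mx L G G' :
  (forall i j, {ae mu, forall x, cube L x -> G x i j - G' x i j = 0}) ->
  {ae mu, forall x, cube L x -> G x = G' x}.
Proof.
move=> h.
have /filter_forall : forall ij : 'I_m * 'I_d.+1,
    {ae mu, forall x, cube L x -> G x ij.1 ij.2 - G' x ij.1 ij.2 = 0}.
  by move=> ij; exact: h.
apply: filterS => x hx Lx; apply/matrixP => i j.
by apply/eqP; rewrite -subr_eq0; apply/eqP; exact: (hx (i, j) Lx).
Qed.

(** Against any test function both gradients yield the same left-hand side of the weak identity, so
    each entry of their difference integrates to zero against it. *)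
Lemma W1p_gradient_unique p L u G G' (z : 'rV[R]_m) : W1p0_pair p.+1 (cube L) u G' ->
  W1p p.+1 (cube L) (fun x => u x + z) G ->
  {ae mu, forall x, cube L x -> G x = G' x}.
Proof.
move=> uG' [_ GL Gw]; have [_ G'L _] := uG'.
apply: ae_eq_mx => i j.
have Gi := inLp_integrable i j GL; have G'i := inLp_integrable i j G'L.
apply: (fundamental_lemma (h := fun x => G x i j - G' x i j)).
  exact: (integrableB_EFin (measurable_cube L) Gi G'i).
move=> phi tphi; have [/smooth_continuous cphi _ _] := tphi.
have phi0 x : ~ cube L x -> phi x = 0 by exact: test_function_eq0 tphi.
under eq_Rintegral do rewrite mulrBl.
rewrite RintegralB; [|exact: measurable_cube|exact: integrable_mul_continuous..].
apply/eqP; rewrite subr_eq0; apply/eqP; apply: oppr_inj.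
by rewrite -(Gw i j phi tphi) (W1p0_pair_weak_gradient z i j uG' tphi).
Qed.

Lemma W1p_gradient_eq0 p L L' u G (z : 'rV[R]_m) : L' <= L ->
  W1p0_pair p.+1 (cube L) u G ->
  {ae mu, forall x, cube L' x -> u x + z = 0} ->
  {ae mu, forall x, cube L' x -> G x = 0}.
Proof.
move=> LL uG u0; have [uL GL _] := uG; have sL := @sub_cube R d.+1 _ _ LL.
apply: (@ae_eq_mx L' G (fun=> 0)) => i j.
have mL := @measurable_cube R d.+1 L; have mL' := @measurable_cube R d.+1 L'.
have Gi := inLp_integrable i j GL.
have : {ae mu, forall x, cube L' x -> G x i j = 0}.
  apply: (fundamental_lemma (h := fun x => G x i j)); first exact: integrableS Gi.
  move=> phi tphi'; have tphi := test_functionS sL tphi'.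
  rewrite Rintegral_supp => [|x nx]; last by rewrite (test_function_eq0 tphi' nx) mulr0.
  rewrite -(Rintegral_supp (D := cube L)) => [|x nx]; last first.
    by rewrite (test_function_eq0 tphi nx) mulr0.
  apply: oppr_inj; rewrite -(W1p0_pair_weak_gradient z i j uG tphi) oppr0.
  rewrite Rintegral_supp => [|x nx]; last by rewrite (test_function_partial0 _ tphi nx) mulr0.
  rewrite -(Rintegral_supp (D := cube L')) => [|x nx]; last first.
    by rewrite (test_function_partial0 _ tphi' nx) mulr0.
  have [sphi _ _] := tphi.
  have mf : measurable_fun (cube L')
      (fun x => (component (fun x => u x + z) i x * partial j phi x)%:E).
    apply/measurable_EFinP; apply: measurable_funM.
      apply: (measurable_funS mL sL); apply: measurable_mx_entry_comp.
      by apply: measurable_fun_mxD; [case: uL|exact: measurable_cst].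
    apply: measurable_funTS; apply: continuous_measurable_mx.
    exact: smooth_continuous_partial.
  rewrite /Rintegral (@ae_eq_integral _ _ _ mu _ (cst 0%E) _ mL' mf (measurable_cst _)).
    by rewrite integral0.
  by apply: filterS u0 => x h /h ux; rewrite /component ux mxE mul0r.
by apply: filterS => x h /h ->; rewrite mxE subr0.
Qed.

(** Exchanges the gradient [G] for the limit of approximating gradients, which can be extended and
    dilated; agreement almost everywhere keeps the energy unchanged. *)
Lemma admissible_pair L (z : 'rV[R]_m) v G : 1 <= L -> admissible L z v G ->
  exists G', [/\ W1p0_pair d.+1 (cube L) (fun x => v x - z) G',
    {ae mu, forall x, cube L x -> G x = G' x} &
    {ae mu, forall x, cube 1 x -> G' x = 0}].
Proof.
move=> L1 [[G' [[uL G'L _] phiP]] v0 vG]; exists G'.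
have uG' : W1p0_pair d.+1 (cube L) (fun x => v x - z) G' by split.
have vE : (fun x => v x - z + z) = v by apply/funext => x; rewrite subrK.
split => //.
- by apply: (W1p_gradient_unique (z := z) uG'); rewrite vE.
- apply: (W1p_gradient_eq0 (z := z) L1 uG').
  by apply: filterS v0 => x h /h; rewrite subrK.
Qed.

Lemma pair_admissible L (z : 'rV[R]_m) u G : W1p0_pair d.+1 (cube L) u G ->
  {ae mu, forall x, cube 1 x -> u x + z = 0} ->
  admissible L z (fun x => u x + z) G.
Proof.
move=> uG u0; split => //; last exact: W1p0_pair_W1p uG.
rewrite (_ : (fun x => u x + z - z) = u); first exact: W1p0_pair_W1p0 uG.
by apply/funext => x; rewrite addrK.
Qed.

Variable g : 'M[R]_(m, d.+1) -> R.
Hypotheses (g_ge0 : forall M, 0 <= g M) (g_cont : continuous g).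
Hypothesis g_homog : homogeneous_of_degree d.+1 g.

Let energy L G : \bar R := (\int[mu]_(x in cube L) (g (G x))%:E)%E.

Lemma energy_ge0 L G : (0 <= energy L G)%E.
Proof. by apply: integral_ge0 => x _; rewrite lee_fin. Qed.

Lemma measurable_energy (D : set rV) G : measurable_fun D G ->
  measurable_fun D (fun x => (g (G x))%:E).
Proof.
move=> mG; apply/measurable_EFinP.
exact: (measurableT_comp (continuous_measurable_mx g_cont) mG).
Qed.

(* Since the exponent equals the dimension, the energy is invariant under
   dilations; the two competitors are glued along the boundary of [Q(L1)]. *)
Lemma cell_min_glue L1 L2 (t1 t2 : R) (a b : 'rV[R]_m) v1 G1 v2 G2 :
  1 <= L1 -> 1 <= L2 -> 0 <= t1 -> 0 <= t2 ->
  admissible L1 a v1 G1 -> admissible L2 b v2 G2 ->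
  (cell_min g (L2 * L1) (t1 *: a + t2 *: b) <=
   (t1 ^+ d.+1)%:E * energy L1 G1 + (t2 ^+ d.+1)%:E * energy L2 G2)%E.
Proof.
move=> L11 L21 t10 t20 adm1 adm2.
have L10 : 0 < L1 by exact: lt_le_trans ltr01 L11.
have r0 : 0 < L1^-1 by rewrite invr_gt0.
have [_ v10 [_ [mG1 _] _]] := adm1; have [_ v20 [_ [mG2 _] _]] := adm2.
have [H1 [p1 G1H1 _]] := admissible_pair L11 adm1.
have [H2 [p2 G2H2 H20]] := admissible_pair L21 adm2.
pose r := L1^-1; pose L := L2 * L1.
have L1L : L1 <= L by rewrite /L ler_peMl// ltW.
(* Subtracting the boundary values [a] and [b] makes both pieces vanish on their outer boundaries;
   [t1 *: a + t2 *: b] is added back to the sum below. *)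
pose u1 x := t1 *: patch (fun=> 0) (cube L1) (fun x => v1 x - a) x.
pose K1 x := t1 *: patch (fun=> 0) (cube L1) H1 x.
pose u2 (x : rV) := t2 *: (v2 (r *: x) - b).
pose K2 (x : rV) := (t2 * r) *: H2 (r *: x).
have q1 : W1p0_pair d.+1 (cube L) u1 K1.
  exact: W1p0_pairZ (W1p0_pair_restrict (ltn0Sn d) L1L p1).
have q2 : W1p0_pair d.+1 (cube L) u2 K2.
  by have := W1p0_pair_dilate t2 r0 p2; rewrite invrK.
have q := W1p0_pairD (measurable_cube L) q1 q2.
have cube_r x : cube 1 (r *: x) <-> cube L1 x.
  by have := scale_cube 1 x r0; rewrite invrK mul1r.
have adm : admissible L (t1 *: a + t2 *: b)
    (fun x => u1 x + u2 x + (t1 *: a + t2 *: b)) (fun x => K1 x + K2 x).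
  (* On Q(1), v1 = 0 gives u1 = -t1 a. Since Q(1) lies in Q(L1), the point r x lies in Q(1), so v2
     vanishes there and u2 = -t2 b. The boundary value cancels both. *)
  apply: pair_admissible => //; have := ae_dilate r0 v20.
  move: v10; apply: filterS2 => x h1 h2 x1.
  have xL1 : cube L1 x by exact: sub_cube x1.
  rewrite /u1 /u2 /patch mem_set// h1// h2; last exact/cube_r.
  by rewrite !sub0r !scalerN addrACA !addNr addr0.
have mK1 : measurable_fun (cube L) K1 by have [_ []] := q1.
have mK2 : measurable_fun (cube L) K2 by have [_ []] := q2.
have mL := @measurable_cube R d.+1 L; have mL1 := @measurable_cube R d.+1 L1.
have sL := @sub_cube R d.+1 _ _ L1L.
have mLL : measurable (cube L `\` cube L1 : set rV) by exact: measurableD.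
have LU : (cube L : set rV) = cube L1 `|` (cube L `\` cube L1) by rewrite setDUK.
apply: (@le_trans _ _ (energy L (fun x => K1 x + K2 x))).
  apply: ereal_inf_lbound.
  by exists (fun x => u1 x + u2 x + (t1 *: a + t2 *: b)), (fun x => K1 x + K2 x).
have mK : measurable_fun (cube L) (fun x => (g (K1 x + K2 x))%:E).
  by apply: measurable_energy; exact: measurable_fun_mxD.
rewrite /energy {1}LU ge0_integral_setU//; first last.
- by apply/disj_setPS => x [h []].
- by move=> x _; rewrite lee_fin.
- by rewrite -LU.
(* Inside Q(L1), r x lies in Q(1), where [H2] vanishes almost everywhere: only t1 [H1] remains and
   homogeneity extracts t1^(d+1). *)
apply: leeD.
  rewrite -ge0_integralZl//; first last.
  - by rewrite lee_fin exprn_ge0.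
  - by move=> x _; rewrite lee_fin.
  - exact: measurable_energy.
  rewrite le_eqVlt; apply/orP; left; apply/eqP; apply: ge0_ae_eq_integral => //.
  - exact: (measurable_funS mL sL mK).
  - by apply: measurable_funeM; exact: measurable_energy.
  - by move=> x _; rewrite lee_fin.
  - by move=> x _; rewrite mule_ge0 ?lee_fin ?exprn_ge0.
  - have := ae_dilate r0 H20; move: G1H1; apply: filterS2 => x h1 h2 xL1.
    rewrite /K1 /K2 /patch mem_set// h2; last exact/cube_r.
    by rewrite scaler0 addr0 -h1// g_homog// EFinM.
(* Outside Q(L1) only the dilated gradient remains. Enlarging the domain back to all of Q(L) can
   only increase the integral, as g >= 0, and makes it a plain dilation of an integral over
   Q(L2). *)
have step : (\int[mu]_(x in cube L `\` cube L1) (g (K1 x + K2 x)%R)%:E <=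
    \int[mu]_(x in cube L) ((t2 * r) ^+ d.+1 * g (H2 (r *: x)))%:E)%E.
  have mH2r : measurable_fun (cube L) (fun x => H2 (r *: x)).
    have [_ [mH2 _] _] := p2; have := measurable_dilate_cube r0 mH2.
    by rewrite invrK.
  apply: (@le_trans _ _ (\int[mu]_(x in cube L `\` cube L1)
      ((t2 * r) ^+ d.+1 * g (H2 (r *: x)))%:E)%E).
    rewrite le_eqVlt; apply/orP; left; apply/eqP; apply: eq_integral => x /set_mem[_ nx].
    rewrite /K1 /K2 /patch memNset// scaler0 add0r g_homog//.
    by rewrite mulr_ge0// ltW.
  apply: ge0_subset_integral => //.
  - apply/measurable_EFinP; apply: measurable_funM => //.
    by apply/measurable_EFinP; exact: measurable_energy.
  - by move=> x _; rewrite lee_fin mulr_ge0 ?exprn_ge0// mulr_ge0// ltW.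
apply: (le_trans step); have [_ [mH2 _] _] := p2.
have mgH2 := measurable_energy mH2.
have := @ge0_integral_dilate_cube _ _ L2 r
  (fun x => ((t2 * r) ^+ d.+1 * g (H2 x))%:E) r0.
rewrite invrK -/L => ->; first last.
- by move=> x; rewrite lee_fin mulr_ge0 ?exprn_ge0// mulr_ge0// ltW.
- by apply/measurable_EFinP; apply: measurable_funM => //; apply/measurable_EFinP.
under eq_integral do rewrite EFinM.
rewrite ge0_integralZl//; first last.
- by rewrite lee_fin exprn_ge0// mulr_ge0// ltW.
- by move=> x _; rewrite lee_fin.
- exact: measurable_cube.
(* The Jacobian r^(-(d+1)) cancels the factor r^(d+1) that homogeneity extracted from the chain
   rule. *)
rewrite muleA -EFinM exprMn mulrCA -exprMn mulfV ?gt_eqF// expr1n mulr1.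
rewrite le_eqVlt; apply/orP; left; apply/eqP; congr (_ * _)%E.
apply: ge0_ae_eq_integral => //.
- exact: measurable_cube.
- exact: measurable_energy.
- by move=> x _; rewrite lee_fin.
- by move=> x _; rewrite lee_fin.
- by move: G2H2; apply: filterS => x h /h ->.
Qed.

Lemma cell_min_ge0 L (z : 'rV[R]_m) : (0 <= cell_min g L z)%E.
Proof. by apply: le_ereal_inf_tmp => _ [v [G [_ ->]]]; exact: energy_ge0. Qed.

Lemma cell_min_le L1 L2 (t1 t2 : R) (a b : 'rV[R]_m) :
  1 <= L1 -> 1 <= L2 -> 0 < t1 -> 0 < t2 ->
  (cell_min g (L2 * L1) (t1 *: a + t2 *: b) <=
   (t1 ^+ d.+1)%:E * cell_min g L1 a + (t2 ^+ d.+1)%:E * cell_min g L2 b)%E.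
Proof.
move=> L11 L21 t10 t20; apply: le_lin_ereal_inf; rewrite ?exprn_gt0//.
- by move=> _ [v [G [_ ->]]]; exact: energy_ge0.
- by move=> _ [v [G [_ ->]]]; exact: energy_ge0.
move=> _ _ [v1 [G1 [adm1 ->]]] [v2 [G2 [adm2 ->]]].
exact: (cell_min_glue L11 L21 (ltW t10) (ltW t20) adm1 adm2).
Qed.

End gluing.

(** * Convexity *)

Section convexity.
Context {R : realType} {m d : nat}.
Variables (g : 'M[R]_(m, d.+1) -> R) (psi : 'rV[R]_m -> R).
Hypothesis g_ge0 : forall M, 0 <= g M.
Hypothesis psi_lim : is_capacitary_density g psi.

Lemma cvg_expR_mul_nat (c : R) : 0 < c -> expR (c * n%:R) @[n --> \oo] --> +oo.
Proof.
move=> c0; apply/cvgryPge => A.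
near=> n; rewrite (le_trans _ (expR_ge1Dx _))// (le_trans (ler_norm A))//.
rewrite -[leLHS]add0r lerD// -ler_pdivrMl//.
rewrite (le_trans (ltW (archi_boundP _)))//; last first.
  by rewrite ler_nat; near: n; exact: nbhs_infty_ge.
by rewrite mulr_ge0// invr_ge0 ltW.
Unshelve. all: by end_near. Qed.

(** Sampling along L = exp(c n) makes log L equal to c n. Taking c = 1, t and s gives L, L^t and L^s
    on one index n. The dimension being d + 1 here, the power of the logarithm is d. *)
Lemma capacitary_density_cvg_nat (c : R) z : 0 < c ->
  (((c * n%:R) ^+ d)%:E * cell_min g (expR (c * n%:R)) z)%E @[n --> \oo]
    --> (psi z)%:E.
Proof.
move=> c0; have := @cvg_comp _ _ _ (fun n => expR (c * n%:R)) _ _ _ _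
  (cvg_expR_mul_nat c0) (@psi_lim z).
rewrite (_ : _ \o _ = fun n =>
  (((c * n%:R) ^+ d)%:E * cell_min g (expR (c * n%:R)) z)%E)//.
by apply/funext => n; rewrite /= expRK.
Qed.

Lemma capacitary_density_ge0 z : 0 <= psi z.
Proof.
have h := @capacitary_density_cvg_nat 1 z ltr01.
rewrite -lee_fin -(cvg_lim _ h)//; apply: lime_ge; first by apply/cvg_ex; eexists; exact: h.
apply: nearW => n; apply: mule_ge0; last exact: cell_min_ge0.
by rewrite lee_fin exprn_ge0// mul1r.
Qed.

Hypotheses (g_cont : continuous g) (g_homog : homogeneous_of_degree d.+1 g).

Lemma capacitary_density_convex_itv (t s : R) a b : 0 < t -> 0 < s -> t + s = 1 ->
  psi (t *: a + s *: b) <= t * psi a + s * psi b.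
Proof.
move=> t0 s0 ts.
have h := @capacitary_density_cvg_nat 1 (t *: a + s *: b) ltr01.
have ha := @capacitary_density_cvg_nat t a t0.
have hb := @capacitary_density_cvg_nat s b s0.
have hab : (t%:E * (((t * n%:R) ^+ d)%:E * cell_min g (expR (t * n%:R)) a) +
    s%:E * (((s * n%:R) ^+ d)%:E * cell_min g (expR (s * n%:R)) b))%E @[n --> \oo]
    --> (t * psi a + s * psi b)%:E.
  by rewrite EFinD !EFinM; apply: cvgeD => //; exact: cvgeZl.
rewrite -lee_fin -(cvg_lim _ h)// -(cvg_lim _ hab)//.
apply: lee_lim; [by apply/cvg_ex; eexists; exact: h|by apply/cvg_ex; eexists; exact: hab|].
apply: nearW => n.
have e1 (c : R) : 0 < c -> 1 <= expR (c * n%:R).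
  by move=> c0; rewrite -expR0 ler_expR mulr_ge0// ltW.
have -> : expR (1 * n%:R) = expR (s * n%:R) * expR (t * n%:R).
  by rewrite -expRD -mulrDl addrC ts.
have n0 : (0 <= ((1 * n%:R) ^+ d : R)%:E)%E by rewrite lee_fin exprn_ge0// mul1r.
apply: le_trans (lee_wpmul2l n0
  (cell_min_le g_ge0 g_cont g_homog a b (e1 _ t0) (e1 _ s0) t0 s0)) _.
(* One power of c is left over: n^d c^(d+1) = c (c n)^d. This turns the weights of [cell_min_le]
   into those of a convex combination. *)
have E (c : R) (x : \bar R) :
    ((n%:R ^+ d)%:E * ((c ^+ d.+1)%:E * x) = c%:E * (((c * n%:R) ^+ d)%:E * x))%E.
  by rewrite !muleA -!EFinM; congr (_%:E * _)%E; rewrite exprMn exprS; ring.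
(* The minima may be infinite for a given n, so distributing the product over the sum in the
   extended reals relies on nonnegativity. *)
have := cell_min_ge0 g_ge0 (expR (t * n%:R)) a.
have := cell_min_ge0 g_ge0 (expR (s * n%:R)) b.
move: (cell_min g _ b) (cell_min g _ a) => y x y0 x0.
have c0 (c : R) (z : \bar R) : 0 < c -> (0 <= z -> 0 <= (c ^+ d.+1)%:E * z)%E.
  by move=> cpos z0; rewrite mule_ge0// lee_fin exprn_ge0// ltW.
by rewrite mul1r (ge0_muleDr _ (c0 _ _ t0 x0) (c0 _ _ s0 y0)) !E.
Qed.

End convexity.

Theorem proposition4p11 (R : realType) (m d : nat) (hm : (1 <= m)%N)
    (hd : (2 <= d)%N) (g : 'M[R]_(m, d) -> R) (psi : 'rV[R]_m -> R)
    (g_ge0 : forall M, 0 <= g M)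
    (g_cont : continuous g)
    (g_homog : homogeneous_of_degree d g)
    (g_growth : exists2 C : R, 0 < C & forall M : 'M[R]_(m, d),
       C^-1 * eucl_norm M ^+ d <= g M <= C * eucl_norm M ^+ d)
    (psi_lim : is_capacitary_density g psi) :
  (forall z, 0 <= psi z) /\
  convex_function [set: convex_lmodType 'rV[R]_m] psi.
Proof.
case: d hd g g_ge0 g_cont g_homog g_growth psi_lim => // d _ g g_ge0 g_cont g_homog _ psi_lim.
split=> [z|t a b _ _]; first exact: (capacitary_density_ge0 g_ge0 psi_lim).
(* The endpoints are set apart because exp(c n) tends to +oo only for c > 0, so both weights must be
   positive. *)
have [->|t0] := eqVneq t 0%:i01; first by rewrite !conv0.
have [->|t1] := eqVneq t 1%:i01; first by rewrite !conv1.
apply: (capacitary_density_convex_itv g_ge0 psi_lim g_cont g_homog).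
- by rewrite lt_neqAle eq_sym t0 ge0.
- by rewrite subr_gt0 lt_neqAle t1 le1.
- by rewrite addrC subrK.
Qed.
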